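(* Let $T=M_wEM_u$ be a weighted conditional type operator that is bounded on $L^2(\mu)$, i.e. $T\in\mathcal{B}(L^2(\mu))$. Then the following conditions are mutually equivalent: (i) $T$ is a $1$-quasi-contraction; (ii) $T$ is an $n$-quasi-contraction for every $n\in\mathbb{N}$; (iii) there exists $n\in\mathbb{N}$ such that $T$ is an $n$-quasi-contraction; (iv) $|E(uw)|\leq 1$ a.e. on $F=S(E(uw))$; (v) $T$ is power bounded; (vi) $\sigma_T\subseteq D$, where $D$ is the closed unit disk in $\mathbb{C}$ and $\sigma_T$ is the spectrum of $T$.
   Context: $(X,\mathcal{F},\mu)$ is a $\sigma$-finite measure space, $\mathcal{A}\subseteq\mathcal{F}$ is a $\sigma$-subalgebra such that $(X,\mathcal{A},\mu|_{\mathcal{A}})$ is also $\sigma$-finite, and $L^p(\mu)=L^p(\mathcal{F})=L^p(X,\mathcal{F},\mu)$ (complex-valued functions). $E=E^{\mathcal{A}}$ is the conditional expectation operator: for $f\ge 0$ measurable or $f\in L^p(\mathcal{F})$, $E(f)$ is the unique $\mathcal{A}$-measurable function with $\int_A E(f)\,d\mu=\int_A f\,d\mu$ for all $A\in\mathcal{A}$ (an $\mathcal{F}$-measurable $f$ for which $E(f)$ exists is called conditionable). For a measurable function $f$, $S(f)=\{x\in X: f(x)\neq 0\}$. Weighted conditional type (WCT) operator: if $u,w:X\to\mathbb{C}$ are $\mathcal{F}$-measurable such that, for all $f\in L^p(\mathcal{F})$ ($1\le p<\infty$), $uf$ is conditionable and $wE(uf)\in L^p(\mathcal{F})$, then the WCT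 operator $M_wEM_u:L^p(\mathcal{F})\to L^p(\mathcal{F})$ is $f\mapsto wE(uf)$. $\mathcal{B}(Y)$ denotes the bounded linear operators on $Y$. For a complex Hilbert space $\mathcal{H}$, $T\in\mathcal{B}(\mathcal{H})$ and $n\in\mathbb{N}=\{1,2,\dots\}$, $T$ is called an $n$-quasi-contraction if $T^{*\,n+1}T^{n+1}\leq T^{*\,n}T^{n}$ (in the order of self-adjoint operators). $T$ is power bounded if $\sup_n\|T^n\|<\infty$. *)

(* Defs.v *)
From HB Require Import structures.
From mathcomp Require Import all_boot all_order all_algebra.
From mathcomp Require Import sesquilinear generic_quotient ring_quotient.
From mathcomp Require Import all_classical all_reals all_analysis.
From mathcomp Require Import measurable_realfun.
From mathcomp.real_closed Require Import complex.

Set Implicit Arguments.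
Unset Strict Implicit.
Unset Printing Implicit Defensive.

Import Order.TTheory GRing.Theory Num.Theory.
Import numFieldNormedType.Exports.

Local Open Scope classical_set_scope.
Local Open Scope ring_scope.

Section complex_valued_functions.
Context d (X : measurableType d) (R : realType).
Implicit Types f g : X -> R[i].

Definition cmeasurable f : Prop :=
  measurable_fun setT (fun x => complex.Re (f x)) /\
  measurable_fun setT (fun x => complex.Im (f x)).

Variable mu : {measure set X -> \bar R}.

Definition cintegrable (D : set X) f : Prop :=
  mu.-integrable D (fun x => (complex.Re (f x))%:E) /\
  mu.-integrable D (fun x => (complex.Im (f x))%:E).

Definition cintegral (D : set X) f : R[i] :=
  Complex (\int[mu]_(x in D) complex.Re (f x)) (\int[mu]_(x in D) complex.Im (f x)).

Lemma eq_cintegral D f g : f =1 g -> cintegral D f = cintegral D g.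
Proof. by move=> /funext ->. Qed.

Lemma cintegralP D (c : R[i]) f g : measurable D ->
  cintegrable D f -> cintegrable D g ->
  cintegral D (fun x => c * f x + g x) = c * cintegral D f + cintegral D g.
Proof.
move=> mD [f1 f2] [g1 g2]; case: c => a b.
have iZ (k : R) (h : X -> R) : mu.-integrable D (fun x => (h x)%:E) ->
    mu.-integrable D (fun x => (k * h x)%:E).
  move=> ih; rewrite (_ : (fun _ => _) = fun x => (k%:E * (h x)%:E)%E)//.
  exact: integrableZl.
have iD (h k : X -> R) : mu.-integrable D (fun x => (h x)%:E) ->
    mu.-integrable D (fun x => (k x)%:E) ->
    mu.-integrable D (fun x => (h x + k x)%:E).
  move=> ih ik; rewrite (_ : (fun _ => _) = (fun x => (h x)%:E + (k x)%:E)%E)//.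
  exact: integrableD.
have L (p q : R) (h k l : X -> R) : mu.-integrable D (fun x => (h x)%:E) ->
    mu.-integrable D (fun x => (k x)%:E) -> mu.-integrable D (fun x => (l x)%:E) ->
    \int[mu]_(x in D) (p * h x + (q * k x + l x)) =
    p * \int[mu]_(x in D) h x +
      (q * \int[mu]_(x in D) k x + \int[mu]_(x in D) l x).
  move=> ih ik il; rewrite RintegralD//; [|exact: iZ|by apply: iD => //; exact: iZ].
  by rewrite RintegralZl// RintegralD//; [rewrite RintegralZl|exact: iZ].
rewrite /cintegral; apply/eqP; rewrite eq_complex /=; apply/andP; split; apply/eqP.
  rewrite -addrA -mulNr -L//; congr Rintegral; apply/funext => x.
  by case: (f x) (g x) => [u v] [u' v'] /=; rewrite mulNr addrA.
rewrite -addrA -L//; congr Rintegral; apply/funext => x.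
by case: (f x) (g x) => [u v] [u' v'] /=; rewrite addrA.
Qed.

Lemma cintegral_conj D f : measurable D -> cintegrable D f ->
  cintegral D (fun x => (f x)^*) = (cintegral D f)^*.
Proof.
move=> mD [f1 f2]; rewrite /cintegral.
apply/eqP; rewrite eq_complex /=; apply/andP; split; apply/eqP.
  by congr Rintegral; apply/funext => x; case: (f x).
rewrite -mulN1r -RintegralZl//; congr Rintegral; apply/funext => x.
by case: (f x) => u v /=; rewrite mulN1r.
Qed.

Lemma ae_eq_cintegral f g : cmeasurable f -> cmeasurable g ->
  (\forall x \ae mu, f x = g x) -> cintegral setT f = cintegral setT g.
Proof.
move=> [f1 f2] [g1 g2] fg; rewrite /cintegral.
by congr Complex; congr fine; apply: ae_eq_integral => //;
  try (exact/measurable_EFinP); apply: filterS fg => x /= ->.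
Qed.

End complex_valued_functions.

Section L2_functions.
Context d (X : measurableType d) (R : realType) (mu : {measure set X -> \bar R}).
Implicit Types f g : X -> R[i].

Definition L2fun : {pred X -> R[i]} :=
  [pred f | `[< cmeasurable f /\
                finite_norm mu 2%:E (fun x => Normc.normc (f x)) >]].

Lemma finite_norm2E (f : X -> R) :
  finite_norm mu 2%:E f <-> (\int[mu]_x (f x ^+ 2)%:E < +oo)%E.
Proof.
have E : (\int[mu]_x (`|(f x)%:E| `^ 2) = \int[mu]_x (f x ^+ 2)%:E)%E.
  by apply: eq_integral => x _; rewrite /= powR_mulrn ?normr_ge0// real_normK ?num_real.
rewrite /finite_norm unlock /= E; split; last by move/poweR_lty; apply.
by apply: lty_poweRy; rewrite invr_neq0// pnatr_eq0.
Qed.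

Lemma sqr_normcE (z : R[i]) :
  Normc.normc z ^+ 2 = complex.Re z ^+ 2 + complex.Im z ^+ 2.
Proof. by case: z => a b /=; rewrite sqr_sqrtr// addr_ge0// sqr_ge0. Qed.

Lemma L2funP f : (f \in L2fun) <->
  ((fun x => complex.Re (f x)) \in Lfun mu 2%:E /\
   (fun x => complex.Im (f x)) \in Lfun mu 2%:E).
Proof.
have LE (h : X -> R) : h \in Lfun mu 2%:E <->
    measurable_fun setT h /\ (\int[mu]_x (h x ^+ 2)%:E < +oo)%E.
  rewrite inE; split.
    by move=> /andP[]; rewrite !inE => mh /finite_norm2E.
  by move=> [mh /finite_norm2E fh]; apply/andP; rewrite !inE.
have mS (h : X -> R) : measurable_fun setT h ->
    measurable_fun setT (fun x => (h x ^+ 2)%:E).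
  by move=> mh; apply/measurable_EFinP; exact: measurable_funX.
have S (fm : cmeasurable f) : (\int[mu]_x (Normc.normc (f x) ^+ 2)%:E =
    \int[mu]_x (complex.Re (f x) ^+ 2)%:E + \int[mu]_x (complex.Im (f x) ^+ 2)%:E)%E.
  rewrite -ge0_integralD//; try (by move=> x _; rewrite lee_fin sqr_ge0);
    try (by apply: mS; case: fm).
  by apply: eq_integral => x _; rewrite sqr_normcE EFinD.
split.
  rewrite inE => -[mf /finite_norm2E]; rewrite (S mf) => fin.
  split; apply/LE; split; try by case: mf.
    apply: le_lt_trans fin; rewrite leeDl//.
    by apply: integral_ge0 => x _; rewrite lee_fin sqr_ge0.
  apply: le_lt_trans fin; rewrite leeDr//.
  by apply: integral_ge0 => x _; rewrite lee_fin sqr_ge0.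
move=> [/LE[m1 f1] /LE[m2 f2]]; rewrite inE; split; first by split.
by apply/finite_norm2E; rewrite S// lte_add_pinfty.
Qed.

Lemma L2fun_submod_closed : submod_closed L2fun.
Proof.
have p1 : (1 <= (2%:E : \bar R))%E by rewrite lee_fin ler1n.
have [L0 LZ] := Lfun_submod_closed mu p1.
split; first by apply/L2funP; split.
move=> c f g /L2funP[f1 f2] /L2funP[g1 g2]; apply/L2funP.
have E1 (a : R) h k : h \in Lfun mu 2%:E -> k \in Lfun mu 2%:E ->
   (fun x => a * h x + k x) \in Lfun mu 2%:E by move=> hL kL; exact: (LZ a h k hL kL).
case: c => a b; split.
  rewrite [X in X \in _](_ : _ = fun x => a * complex.Re (f x) +
      (- b * complex.Im (f x) + complex.Re (g x))).
    exact: E1 _ _ _ f1 (E1 _ _ _ f2 g1).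
  apply/funext => x; rewrite !fctE /=.
  by case: (f x) (g x) => [u v] [s t] /=; rewrite mulNr addrA.
rewrite [X in X \in _](_ : _ = fun x => a * complex.Im (f x) +
    (b * complex.Re (f x) + complex.Im (g x))).
  exact: E1 _ _ _ f2 (E1 _ _ _ f1 g2).
apply/funext => x; rewrite !fctE /=.
by case: (f x) (g x) => [u v] [s t] /=; rewrite addrA.
Qed.

HB.instance Definition _ :=
  GRing.isSubmodClosed.Build _ _ L2fun L2fun_submod_closed.

Record L2funType := L2FunType {
  L2val :> X -> R[i] ;
  L2valP : L2val \in L2fun }.

HB.instance Definition _ := [isSub for L2val].
HB.instance Definition _ := [Choice of L2funType by <:].
HB.instance Definition _ := [SubChoice_isSubLmodule of L2funType by <:].

Definition L2null : {pred L2funType} :=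
  [pred f : L2funType | `[< \forall x \ae mu, f x = 0 >]].

Lemma L2null_zmod_closed : zmod_closed L2null.
Proof.
split; first by rewrite inE; exact: aeW.
move=> f g; rewrite !inE => f0 g0.
by apply: filterS2 f0 g0 => x /= fx gx; rewrite !fctE fx gx subrr.
Qed.

HB.instance Definition _ :=
  GRing.isZmodClosed.Build _ L2null L2null_zmod_closed.

Definition L2 : Type := Quotient.quot L2null.
HB.instance Definition _ := GRing.Zmodule.on L2.
HB.instance Definition _ := EqQuotient.on L2.

Local Open Scope quotient_scope.

Lemma L2_eqP (f g : L2funType) :
  \pi_L2 f = \pi_L2 g <-> \forall x \ae mu, f x = g x.
Proof.
split.
  move=> /eqP; rewrite -Quotient.idealrBE inE => fg.
  by apply: filterS fg => x /=; rewrite !fctE => /subr0_eq.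
move=> fg; apply/eqP; rewrite -Quotient.idealrBE inE.
by apply: filterS fg => x /= fgx; rewrite !fctE fgx subrr.
Qed.

Lemma L2_repr (f : L2funType) : \forall x \ae mu, repr (\pi_L2 f) x = f x.
Proof. by apply/L2_eqP; rewrite reprK. Qed.

Definition L2scale (c : R[i]) (f : L2) : L2 := \pi_L2 (c *: repr f).

Lemma L2scale_pi c (f : L2funType) : L2scale c (\pi_L2 f) = \pi_L2 (c *: f).
Proof.
apply/L2_eqP; apply: filterS (L2_repr f) => x /= fx.
by rewrite !fctE fx.
Qed.

Fact L2scaleA a b (f : L2) : L2scale a (L2scale b f) = L2scale (a * b) f.
Proof. by elim/quotW: f => f; rewrite (L2scale_pi b) !L2scale_pi scalerA. Qed.

Fact L2scale1 : left_id 1 L2scale.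
Proof. by elim/quotW=> f; rewrite L2scale_pi scale1r. Qed.

Fact L2scaleDr : right_distributive L2scale +%R.
Proof.
move=> c; elim/quotW=> f; elim/quotW=> g.
by rewrite -raddfD !L2scale_pi scalerDr raddfD.
Qed.

Fact L2scaleDl (f : L2) : {morph L2scale^~ f : a b / a + b}.
Proof.
by move=> a b; elim/quotW: f => f; rewrite !L2scale_pi scalerDl raddfD.
Qed.

HB.instance Definition _ := GRing.Zmodule_isLmodule.Build R[i] L2
  L2scaleA L2scale1 L2scaleDr L2scaleDl.

Definition L2ip (f g : L2) : R[i] :=
  cintegral mu setT (fun x => repr f x * (repr g x)^*).

Lemma L2fun_mul_conj f g : f \in L2fun -> g \in L2fun ->
  cintegrable mu setT (fun x => f x * (g x)^*).
Proof.
move=> /L2funP[f1 f2] /L2funP[g1 g2].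
have I (h k : X -> R) : h \in Lfun mu 2%:E -> k \in Lfun mu 2%:E ->
    mu.-integrable setT (fun x => (h x * k x)%:E).
  by move=> hL kL; apply/Lfun1_integrable; exact: Lfun2_mul_Lfun1.
split.
  rewrite (_ : (fun _ => _) = fun x => ((complex.Re (f x) * complex.Re (g x))%:E
      + (complex.Im (f x) * complex.Im (g x))%:E)%E).
    by apply: integrableD => //; exact: I.
  apply/funext => x; case: (f x) (g x) => [a b] [a' b'] /=.
  by rewrite mulrN opprK.
rewrite (_ : (fun _ => _) = fun x => ((complex.Im (f x) * complex.Re (g x))%:E
    - (complex.Re (f x) * complex.Im (g x))%:E)%E).
  by apply: integrableB => //; exact: I.
apply/funext => x; case: (f x) (g x) => [a b] [a' b'] /=.
by rewrite mulrN addrC.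
Qed.

Lemma cintegrable_cmeasurable (h : X -> R[i]) :
  cintegrable mu setT h -> cmeasurable h.
Proof.
by move=> [h1 h2]; split; apply/measurable_EFinP;
  [case/integrableP : h1|case/integrableP : h2].
Qed.

Lemma L2ip_pi (f g : L2funType) :
  L2ip (\pi_L2 f) (\pi_L2 g) = cintegral mu setT (fun x => f x * (g x)^*).
Proof.
apply: ae_eq_cintegral.
- by apply: cintegrable_cmeasurable; apply: L2fun_mul_conj; exact: L2valP.
- by apply: cintegrable_cmeasurable; apply: L2fun_mul_conj; exact: L2valP.
- by apply: filterS2 (L2_repr f) (L2_repr g) => x -> ->.
Qed.

Lemma L2ip_linearl (h : L2) : linear_for *%R (L2ip^~ h).
Proof.
move=> c; elim/quotW=> f; elim/quotW=> g; elim/quotW: h => h.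
rewrite [c *: _]L2scale_pi -raddfD !L2ip_pi -cintegralP//; last 2 first.
- by apply: L2fun_mul_conj; exact: L2valP.
- by apply: L2fun_mul_conj; exact: L2valP.
apply: eq_cintegral => x.
by rewrite -[(_ + _ : L2funType) x]/(c * f x + g x) mulrDl mulrA.
Qed.

Lemma L2ip_conj (f g : L2) : L2ip f g = (L2ip g f)^*.
Proof.
rewrite /L2ip -cintegral_conj//; last by apply: L2fun_mul_conj; exact: L2valP.
by apply: eq_cintegral => x; rewrite rmorphM/= conjCK mulrC.
Qed.

Lemma L2ip_linearr (h : L2) : linear_for (Num.conj \; *%R) (L2ip h).
Proof.
move=> c f g; rewrite [LHS]L2ip_conj [L2ip h f]L2ip_conj [L2ip h g]L2ip_conj.
by rewrite L2ip_linearl rmorphD rmorphM.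
Qed.

HB.instance Definition _ := bilinear_isBilinear.Build R[i] L2 L2 R[i]
  *%R (Num.conj \; *%R) L2ip (L2ip_linearl, L2ip_linearr).

Lemma L2ip_hermitian (f g : L2) : L2ip f g = (-1) ^+ false * (L2ip g f)^*.
Proof. by rewrite expr0 mul1r -L2ip_conj. Qed.

HB.instance Definition _ := isHermitianSesquilinear.Build R[i] L2 false Num.conj
  L2ip L2ip_hermitian.

Lemma L2ip_gt0 (f : L2) : f != 0 -> 0 < L2ip f f.
Proof.
elim/quotW: f => f f0; rewrite L2ip_pi.
have E x : f x * (f x)^* = (Normc.normc (f x) ^+ 2)%:C%C.
  by rewrite sqr_normcE; case: (f x) => a b; apply/eqP;
    rewrite eq_complex /= mulrN opprK -!expr2 eqxx /= mulrN mulrC addNr.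
have mE : mu.-integrable setT (fun x => (Normc.normc (f x) ^+ 2)%:E).
  have [+ _] := L2fun_mul_conj (L2valP f) (L2valP f).
  by under eq_fun do rewrite E.
rewrite (eq_cintegral _ _ E) /cintegral /=.
rewrite ltcE /= Rintegral_cst// mul0r eqxx /=.
rewrite lt_neqAle Rintegral_ge0 ?andbT; last by move=> x _; rewrite sqr_ge0.
apply: contra f0 => /eqP I0.
have /ae_eq_integral_abs : (\int[mu]_x `|(Normc.normc (f x) ^+ 2)%:E| = 0)%E.
  under eq_integral do rewrite gee0_abs ?lee_fin ?sqr_ge0//.
  by rewrite -[LHS]fineK ?integrable_fin_num// -[fine _]/(Rintegral _ _ _) -I0.
move=> /(_ measurableT) ae0.
rewrite -(raddf0 \pi_L2); apply/eqP/L2_eqP.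
have := ae0 _; case/integrableP : mE => mE _ /(_ mE).
apply: filterS => x /= /(_ I) [] /eqP; rewrite sqrf_eq0 => /eqP.
exact: Normc.eq0_normc.
Qed.

HB.instance Definition _ := isDotProduct.Build R[i] L2 L2ip L2ip_gt0.

End L2_functions.

Arguments L2 {d X R} mu.
Arguments L2ip {d X R} mu.

Section operators.
Context (R : realType) (V : lmodType R[i]) (ip : {dot V for @Num.conj R[i]}).
Implicit Types (S T : V -> V) (x y : V).

Definition hnorm x : R := Num.sqrt (complex.Re (ip x x)).

Definition bounded_op T : Prop :=
  linear T /\ exists M : R, forall x, hnorm (T x) <= M * hnorm x.

Definition opnorm T : \bar R :=
  ereal_sup [set (hnorm (T x))%:E | x in [set x | hnorm x <= 1]].

Definition power_bounded T : Prop :=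
  (ereal_sup [set opnorm (iter n T) | n in [set n | (0 < n)%N]] < +oo)%E.

(* The adjoint is unique when it exists (ip is definite), and it exists for
   every bounded operator on a Hilbert space. *)
Definition adjoint T : V -> V :=
  xget (fun=> 0) [set S | forall x y, ip (T x) y = ip x (S y)].

Definition op_le S T : Prop := forall x, 0 <= ip (T x - S x) x.

Definition quasi_contraction (n : nat) T : Prop :=
  op_le (iter n.+1 (adjoint T) \o iter n.+1 T) (iter n (adjoint T) \o iter n T).

Definition spectrum T : set R[i] :=
  [set z | ~ exists S, [/\ bounded_op S,
                           forall x, S (T x - z *: x) = x &
                           forall x, T (S x) - z *: S x = x]].

End operators.

Section conditional_expectation.
Context d (X : measurableType d) (R : realType) (mu : {measure set X -> \bar R}).
Variable A : set (set X).

Definition is_condexp_ge0 (f e : X -> \bar R) : Prop :=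
  [/\ forall x, (0 <= e x)%E,
      measurable_fun setT (e : g_sigma_algebraType A -> \bar R) &
      forall B, A B -> (\int[mu]_(x in B) e x = \int[mu]_(x in B) f x)%E].

(* For f in L^p with p > 1 the integral of f over B in A need not exist, so the
   defining identity ranges over those B on which f is integrable. The condition
   E(|f|) < +oo a.e. makes X, up to a null set, a countable union of such B (for
   sigma-finite A), so that g is unique up to a.e. equality. *)
Definition is_condexp (f g : X -> R[i]) : Prop :=
  [/\ exists2 e, is_condexp_ge0 (fun x => (Normc.normc (f x))%:E) e &
                 \forall x \ae mu, (e x < +oo)%E,
      @cmeasurable _ (g_sigma_algebraType A) R g &
      forall B, A B -> cintegrable mu B f ->
        cintegrable mu B g /\ cintegral mu B g = cintegral mu B f].

Definition conditionable (f : X -> R[i]) : Prop :=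
  cmeasurable f /\ exists g, is_condexp f g.

Definition condexp (f : X -> R[i]) : X -> R[i] := xget (cst 0) (is_condexp f).

(* The standing assumptions under which M_w E M_u is a WCT operator on L^2. *)
Definition WCT_weights (u w : X -> R[i]) : Prop :=
  [/\ cmeasurable u, cmeasurable w &
      forall f, f \in L2fun mu ->
        conditionable (fun x => u x * f x) /\
        (fun x => w x * condexp (fun x => u x * f x) x) \in L2fun mu].

(* The class of f in L^2, and 0 when f is not square integrable. *)
Definition L2class (f : X -> R[i]) : L2 mu :=
  \pi_(L2 mu)%qT (insubd (0 : L2funType mu) f).

Definition WCT (u w : X -> R[i]) (f : L2 mu) : L2 mu :=
  L2class (fun x => w x * condexp (fun x => u x * repr f x) x).

End conditional_expectation.

Arguments WCT {d X R} mu A u w f.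

(* Main.v *)
(* Write phi = E(uw). If p = h T x with h measurable for the subalgebra, the
   pull-out property gives T p = h phi T x: on its range, T multiplies by phi, and
   T^(k+1) x = phi^k T x. Hence |phi| <= 1 a.e. yields the contraction
   inequalities, power boundedness, and for |z| > 1 the explicit resolvent
   - z^-1 (1 + (z - phi)^-1 T).

   Conversely each condition is tested on p = 1_S T x with S in the subalgebra.
   If |phi| >= c > 1 on S then |T^k p| >= c^k |p|; if |phi - z| < e on S then
   |(T - z) p| <= e |p|. A quasi-contraction inequality, a bound on the powers, or
   a bounded inverse of T - z with e small then forces 1_S T x = 0 for all x, hence
   phi = 0 a.e. on S. For the spectrum, countably many rational discs cover the
   complement of the closed unit disc.

   Rewriting quasi-contractivity as |T^(n+1) x| <= |T^n x| needs the adjoint of T,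
   which is exhibited as y |-> conj (u E(w conj y)). *)

Require Import Defs.
From HB Require Import structures.
From mathcomp Require Import all_boot all_order all_algebra.
From mathcomp Require Import sesquilinear generic_quotient ring_quotient.
From mathcomp Require Import all_classical all_reals all_analysis.
From mathcomp Require Import measurable_realfun.
From mathcomp Require Import ring lra.
From mathcomp.real_closed Require Import complex.

Set Implicit Arguments.
Unset Strict Implicit.
Unset Printing Implicit Defensive.

Import Order.TTheory GRing.Theory Num.Theory.
Import numFieldNormedType.Exports.

Local Open Scope classical_set_scope.
Local Open Scope ring_scope.

(** * Conditional expectations of real functions *)

(** Only [u f] with [f] in L^2 is assumed conditionable. Neither [u w] nor products of [w] with L^2
    functions come with a conditional expectation, and no integrability of [w] by itself is
    available. The remedy is a single vector [x0] with [T x0 = w r], where [r] is measurable for the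
    subalgebra and [u] vanishes a.e. where [r] does: then [u w = r^-1 u T x0] a.e., so [phi] exists
    by pulling out the unbounded factor [r^-1]. This calls for a pull-out property without
    boundedness or global integrability; it rests on domination by E|f| and on exhausting the space
    by members of the subalgebra on which |f| is integrable. The same vector explains why the test
    sets detect [phi]: [1_S T x0 = 0] gives [1_S u w = 0], hence [1_S phi = 0]. Finally, [adjoint]
    is a choice with default value 0, so an operator satisfying its defining identity must be
    produced before quasi-contractivity says anything about norms. The obstacle there is the square
    integrability of the candidate, which is drawn from the boundedness of [T]. *)

Section subalgebra.
Context d (X : measurableType d) (R : realType) (mu : {measure set X -> \bar R}).
Context (A : set (set X)) (A_sigma : sigma_algebra setT A)
  (A_sub : A `<=` measurable).
Local Notation XA := (g_sigma_algebraType A).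

Lemma measurable_subalgebraE : @measurable _ XA = A.
Proof. exact: measurable_g_measurableTypeE. Qed.

Lemma subalgebra_measurable (B : set XA) : measurable B -> A B.
Proof. by rewrite measurable_subalgebraE. Qed.

Lemma measurable_subalgebra (B : set XA) : A B -> measurable B.
Proof. by rewrite measurable_subalgebraE. Qed.

Lemma subalgebraI (B C : set X) : A B -> A C -> A (B `&` C).
Proof.
by move=> /measurable_subalgebra ? /measurable_subalgebra ?;
  apply: subalgebra_measurable; exact: measurableI.
Qed.

Lemma subalgebraT : A setT.
Proof. exact/subalgebra_measurable. Qed.

Lemma subalgebra_lt (s t : XA -> R) :
  measurable_fun setT s -> measurable_fun setT t -> A [set x | s x < t x].
Proof.
move=> ms mt; apply: subalgebra_measurable.
by rewrite -[X in measurable X]setTI; exact: measurable_fun_ltr.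
Qed.

Lemma subalgebra_le (s t : XA -> R) :
  measurable_fun setT s -> measurable_fun setT t -> A [set x | s x <= t x].
Proof.
move=> ms mt; apply: subalgebra_measurable.
by rewrite -[X in measurable X]setTI; exact: measurable_fun_ler.
Qed.

Lemma subalgebra_preimage1 (s : XA -> R) (y : R) :
  measurable_fun setT s -> A (s @^-1` [set y]).
Proof.
move=> ms; apply: subalgebra_measurable.
by rewrite -[X in measurable X]setTI; exact: ms.
Qed.

Lemma measurable_fun_subalgebra d' (Y : measurableType d') (f : X -> Y) :
  measurable_fun setT (f : XA -> Y) -> measurable_fun setT f.
Proof.
move=> mf _ B mB; apply: A_sub; rewrite -measurable_subalgebraE.
exact: (mf measurableT).
Qed.

Import HBNNSimple.

(** The right-hand side sees [v] only through its integrals over members of the subalgebra, so two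
    functions with the same such integrals may be exchanged against [h]. *)
Lemma ge0_integral_mul_approx (h : XA -> R) (v : X -> R) (B : set X)
    (mh : measurable_fun setT (EFin \o h)) :
  (forall x, 0 <= h x) -> measurable_fun setT v -> (forall x, 0 <= v x) -> A B ->
  let k := nnsfun_approx measurableT mh in
  (\int[mu]_(x in B) (h x * v x)%:E = limn (fun n => \sum_(y \in range (k n))
     y%:E * \int[mu]_(x in B `&` k n @^-1` [set y]) (v x)%:E))%E.
Proof.
move=> h0 mv v0 AB k; have mB := A_sub AB.
have mk n : measurable_fun setT (k n : X -> R).
  by apply: measurable_fun_subalgebra; exact/measurable_funP.
have mkx n y : measurable (k n @^-1` [set y] : set X).
  by rewrite -[X in measurable X]setTI; exact: (mk n).
have -> : (\int[mu]_(x in B) (h x * v x)%:E =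
    limn (fun n => \int[mu]_(x in B) (k n x * v x)%:E))%E.
  have hv x : B x -> (h x * v x)%:E = limn (fun n => (k n x * v x)%:E).
    move=> _; apply/esym/cvg_lim => //.
    rewrite (_ : (fun n => _) = fun n => ((EFin \o k ^~ x) n * (v x)%:E)%E) //.
    rewrite EFinM; apply: cvgeZr => //.
    by apply: cvg_nnsfun_approx => // y _; rewrite lee_fin.
  under eq_integral => x /[!inE] /hv -> //.
  apply: monotone_convergence => //.
  - move=> n; apply/measurable_EFinP; apply: measurable_funTS.
    by apply: measurable_funM.
  - by move=> n x _; rewrite lee_fin mulr_ge0.
  - move=> x _ a b ab; rewrite lee_fin ler_wpM2r//.
    have /lefP := nd_nnsfun_approx measurableT mh ab; exact.
congr (limn _); apply/funext => n.
transitivity (\int[mu]_(x in B) \sum_(y \in range (k n))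
   (y%:E * (\1_(k n @^-1` [set y]) x * v x)%:E))%E.
  apply: eq_integral => x _; rewrite {1}(fimfunE (k n) x).
  rewrite EFinM -fsumEFin// ge0_mule_fsuml.
    by apply: eq_fsbigr => y _; rewrite !EFinM muleA.
  by move=> y; exact: nnfun_muleindic_ge0.
rewrite ge0_integral_fsum//; last 2 first.
- move=> y; apply/measurable_EFinP; apply: measurable_funTS.
  by apply: measurable_funM => //; apply: measurable_funM.
- by move=> y x _; rewrite EFinM muleA mule_ge0 ?lee_fin//; exact: nnfun_muleindic_ge0.
apply: eq_fsbigr => y; rewrite inE => -[t _ kty].
rewrite ge0_integralZl//; last first.
  by rewrite lee_fin -kty.
- by move=> x _; rewrite lee_fin mulr_ge0// indicE.
- apply/measurable_EFinP; apply: measurable_funTS.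
  by apply: measurable_funM.
congr (_ * _)%E; rewrite integral_mkcondr; apply: eq_integral => x _.
rewrite patchE; case: ifPn => xk; rewrite indicE.
  by rewrite xk mul1r.
by rewrite (negbTE xk) mul0r.
Qed.
End subalgebra.

(** * Pull-out and comparison for nonnegative functions *)

Section ge0_condexp.
Context d (X : measurableType d) (R : realType) (mu : {measure set X -> \bar R}).
Context (A : set (set X)) (A_sigma : sigma_algebra setT A)
  (A_sub : A `<=` measurable).
Local Notation XA := (g_sigma_algebraType A).

(** Real-valued variant of [is_condexp_ge0]: excluding the value +oo keeps products in [R] and lets
    [e] cut the space into sets where [m] is integrable. *)
Definition ge0_condexp (m e : X -> R) : Prop :=
  [/\ measurable_fun setT m, forall x, 0 <= m x,
      measurable_fun setT (e : XA -> R), forall x, 0 <= e x &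
      forall B, A B -> (\int[mu]_(x in B) (e x)%:E = \int[mu]_(x in B) (m x)%:E)%E].

Import HBNNSimple.

Lemma ge0_condexpM (h : XA -> R) (m e : X -> R) :
  measurable_fun setT h -> (forall x, 0 <= h x) -> ge0_condexp m e ->
  ge0_condexp (fun x => h x * m x) (fun x => h x * e x).
Proof.
move=> mh h0 [mm m0 me e0 me_eq]; split.
- by apply: measurable_funM => //; exact: (measurable_fun_subalgebra A_sigma A_sub mh).
- by move=> x; rewrite mulr_ge0.
- exact: measurable_funM.
- by move=> x; rewrite mulr_ge0.
move=> B AB; have mh' : measurable_fun setT (EFin \o h) by exact/measurable_EFinP.
rewrite !(@ge0_integral_mul_approx _ _ _ mu A A_sigma A_sub h _ _ mh')//; last first.
  exact: (measurable_fun_subalgebra A_sigma A_sub me).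
congr (limn _); apply/funext => n; apply: eq_fsbigr => y _; congr (_ * _)%E.
apply: me_eq; apply: (subalgebraI A_sigma AB).
by apply: (subalgebra_preimage1 A_sigma); exact/measurable_funP.
Qed.

(** The hypothesis is tested on the part of [D] where [t < s]: there [s - t] is positive with
    integral at most 0, so this part is null. Integrability on [D] makes the subtraction of
    integrals legitimate. *)
Lemma le_ae_subalgebra (D : set X) (s t : X -> R) : A D ->
  measurable_fun setT (s : XA -> R) -> measurable_fun setT (t : XA -> R) ->
  mu.-integrable D (EFin \o s) -> mu.-integrable D (EFin \o t) ->
  (forall B, B `<=` D -> A B ->
    (\int[mu]_(x in B) (s x)%:E <= \int[mu]_(x in B) (t x)%:E)%E) ->
  \forall x \ae mu, D x -> s x <= t x.
Proof.
move=> AD ms mt si ti st.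
pose B := D `&` [set x | t x < s x].
have AB : A B by apply: subalgebraI => //; exact: subalgebra_lt.
have mB := A_sub AB.
have siB : mu.-integrable B (EFin \o s).
  by apply: integrableS si; [exact: A_sub|exact: mB|exact: subIsetl].
have tiB : mu.-integrable B (EFin \o t).
  by apply: integrableS ti; [exact: A_sub|exact: mB|exact: subIsetl].
have st0 : (\int[mu]_(x in B) `|(s x - t x)%:E| = 0)%E.
  apply/eqP; rewrite eq_le integral_ge0// andbT.
  rewrite (eq_integral (fun x => (s x)%:E - (t x)%:E)%E); last first.
    by move=> x; rewrite inE => -[_ /= xB]; rewrite ger0_norm ?subr_ge0 ?EFinB// ltW.
  rewrite integralB_EFin// sube_le0; apply: st => //; exact: subIsetl.
have : measurable_fun B (EFin \o (fun x => s x - t x)).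
  apply/measurable_EFinP; apply: measurable_funTS; apply: measurable_funB.
    exact: (measurable_fun_subalgebra A_sigma A_sub ms).
  exact: (measurable_fun_subalgebra A_sigma A_sub mt).
move/ae_eq_integral_abs => /(_ mu mB) [+ _] => /(_ st0).
apply: filterS => x /= stx Dx; rewrite leNgt; apply/negP => xB.
have [] := stx (conj Dx xB) => /eqP; rewrite subr_eq0 => /eqP sxt.
by rewrite sxt ltxx in xB.
Qed.

(* A strictly positive square-integrable weight replaces exhaustions of X by
   sets of finite measure. *)
Lemma sigma_finite_weight : sigma_finite [set: XA] mu ->
  exists rho : X -> R, [/\ measurable_fun setT (rho : XA -> R),
    forall x, 0 < rho x, forall x, rho x <= 1 &
    (\int[mu]_x (rho x ^+ 2)%:E < +oo)%E].
Proof.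
move=> [F UF mF].
have mFX n : measurable (F n : set X).
  by apply: A_sub; have [+ _] := mF n; rewrite measurable_subalgebraE.
have finF n : mu (F n) \is a fin_num by rewrite ge0_fin_numE//; case: (mF n).
(* Chosen so that [c n] times the measure of [F n] is at most 2^-(n+1), with sum at most 1; the
   summand 1 keeps the denominator positive when [F n] is null. *)
pose c n : R := (1 / (2 ^ n.+1)%:R) / (1 + fine (mu (F n))).
have c0 n : 0 < c n.
  by rewrite !divr_gt0// ?ltr0n ?expn_gt0// ltr_wpDr// fine_ge0.
pose p x : \bar R := (\sum_(n <oo) (c n * \1_(F n) x)%:E)%E.
have pE x n : (0 <= (c n * \1_(F n) x)%:E)%E.
  by rewrite lee_fin mulr_ge0 ?(ltW (c0 n)).
have p0 x : (0 < p x)%E.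
  have : [set: X] x by []; rewrite UF => -[n _ Fnx].
  apply: (@lt_le_trans _ _ (c n * \1_(F n) x)%:E).
    by rewrite indicE mem_set// mulr1 lte_fin.
  rewrite /p (nneseriesD1 (n := n))// leeDl//.
  by apply: nneseries_ge0 => k _ _; exact: pE.
have mp : measurable_fun setT (p : XA -> \bar R).
  apply: ge0_emeasurable_sum => [n x _ _|n _]; first exact: pE.
  apply/measurable_EFinP; apply: measurable_funM => //.
  by apply: measurable_indic; have [] := mF n.
have pfin x : mine (p x) 1%E \is a fin_num.
  rewrite ge0_fin_numE ?le_min ?(ltW (p0 x)) ?lee01//.
  by rewrite gt_min ltry orbT.
have pmin0 x : (0 < mine (p x) 1)%E by rewrite lt_min p0 lte01.
(* Capping at 1 gives [rho ^+ 2 <= rho <= p], so the square is dominated by the integrable [p]. *)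
exists (fun x => fine (mine (p x) 1%E)); split.
- by apply: measurableT_comp => //; exact: measurable_mine.
- by move=> x; rewrite fine_gt0// pmin0/= ltey_eq pfin.
- by move=> x; rewrite -lee_fin fineK// ge_min lexx orbT.
apply: (@le_lt_trans _ _ (\int[mu]_x p x)%E).
  apply: ge0_le_integral => //.
  - by move=> x _; rewrite lee_fin sqr_ge0.
  - apply/measurable_EFinP; apply: measurable_funX.
    apply: measurableT_comp => //; apply: measurable_mine => //.
    exact: (measurable_fun_subalgebra A_sigma A_sub mp).
  - exact: (measurable_fun_subalgebra A_sigma A_sub mp).
  move=> x _; apply: (@le_trans _ _ (mine (p x) 1%E)); last first.
    by rewrite ge_min lexx.
  rewrite -[leRHS]fineK// lee_fin expr2 ler_piMl//.
    by rewrite fine_ge0// ltW.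
  by rewrite -lee_fin fineK// ge_min lexx orbT.
rewrite integral_nneseries//; last first.
  by move=> n; apply/measurable_EFinP; apply: measurable_funM.
apply: (@le_lt_trans _ _ 1%:E); last exact: ltry.
apply: le_trans (epsilon_trick0 xpredT ler01).
apply: lee_nneseries => [n _ _|n _].
  by apply: integral_ge0 => x _; exact: pE.
under eq_integral do rewrite EFinM.
rewrite ge0_integralZl//; [|exact/measurable_EFinP|by rewrite lee_fin ltW].
rewrite integral_indic// setIT -[mu _]fineK// -EFinM lee_fin /c !div1r -mulrA.
rewrite ler_piMr// mulrC ler_pdivrMr ?mul1r ?lerDr//.
Qed.
End ge0_condexp.

(** * Domination and pull-out for real functions *)

Section real_condexp.
Context d (X : measurableType d) (R : realType) (mu : {measure set X -> \bar R}).
Context (A : set (set X)) (A_sigma : sigma_algebra setT A)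
  (A_sub : A `<=` measurable).
Local Notation XA := (g_sigma_algebraType A).
Context (A_sigma_finite : sigma_finite [set: XA] mu).
Local Notation ge0_condexp := (ge0_condexp mu A).

(** Cut along [e <= k rho^2], a condition measurable for the subalgebra: on such a set [m] and [e]
    have the same integral, at most [k] times that of [rho^2]. The sets cover the space because
    [rho] is positive and [e] finite. *)
Lemma ge0_condexp_exhaustion (m e : X -> R) : ge0_condexp m e ->
  exists F : nat -> set X, [/\ forall k, A (F k), \bigcup_k F k = setT,
    forall k, mu.-integrable (F k) (EFin \o m) &
    forall k, mu.-integrable (F k) (EFin \o e)].
Proof.
move=> [mm m0 me e0 em].
have [rho [mrho rho0 rho1 rhofin]] := sigma_finite_weight A_sigma A_sub A_sigma_finite.
pose F k := [set x | e x <= k%:R * rho x ^+ 2].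
have AF k : A (F k).
  apply: subalgebra_le => //; apply: measurable_funM => //.
  exact: measurable_funX.
have meX := measurable_fun_subalgebra A_sigma A_sub me.
have mrhoX := measurable_fun_subalgebra A_sigma A_sub mrho.
have Ffin k : (\int[mu]_(x in F k) (e x)%:E < +oo)%E.
  apply: (@le_lt_trans _ _ (\int[mu]_(x in F k) (k%:R * rho x ^+ 2)%:E)%E).
    apply: ge0_le_integral => //.
    - exact: A_sub.
    - by move=> x _; rewrite lee_fin.
    - exact/measurable_EFinP/measurable_funTS.
    - by apply/measurable_EFinP/measurable_funTS/measurable_funM => //;
        exact: measurable_funX.
  under eq_integral do rewrite EFinM.
  rewrite ge0_integralZl//; first last.
  - by move=> x _; rewrite lee_fin sqr_ge0.
  - by apply/measurable_EFinP/measurable_funTS; exact: measurable_funX.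
  - exact: A_sub.
  rewrite lte_mul_pinfty ?lee_fin//; apply: le_lt_trans rhofin.
  apply: ge0_subset_integral => //; first exact: A_sub.
  - by apply/measurable_EFinP; exact: measurable_funX.
  - by move=> x _; rewrite lee_fin sqr_ge0.
exists F; split => //.
- apply/seteqP; split => // x _.
  exists (Num.truncn (e x / rho x ^+ 2)).+1 => //=.
  rewrite /F /= -ler_pdivrMr ?exprn_gt0//; apply/ltW.
  by rewrite truncnS_gt.
- move=> k; apply/integrableP; split.
    exact/measurable_EFinP/measurable_funTS.
  by under eq_integral do rewrite /= ger0_norm//; rewrite -em.
- move=> k; apply/integrableP; split.
    exact/measurable_EFinP/measurable_funTS.
  by under eq_integral do rewrite /= ger0_norm//.
Qed.

(** Test sets inside the pieces of a countable cover suffice: any [B] is split along the disjoint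
    sets [seqDU F], and integrals of nonnegative functions are countably additive. *)
Lemma ge0_condexp_local (m e : X -> R) (F : nat -> set X) :
  measurable_fun setT m -> (forall x, 0 <= m x) ->
  measurable_fun setT (e : XA -> R) -> (forall x, 0 <= e x) ->
  (forall k, A (F k)) -> \bigcup_k F k = setT ->
  (forall k B, B `<=` F k -> A B ->
    (\int[mu]_(x in B) (e x)%:E = \int[mu]_(x in B) (m x)%:E)%E) ->
  ge0_condexp m e.
Proof.
move=> mm m0 me e0 AF UF FB; split => // B AB.
have meX := measurable_fun_subalgebra A_sigma A_sub me.
pose G k := B `&` seqDU F k.
have AG k : A (G k).
  apply: (subalgebraI A_sigma AB); apply: (subalgebra_measurable A_sigma).
  apply: (@seqDU_measurable _ XA) => j.
  exact: (measurable_subalgebra A_sigma (AF j)).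
have BG : B = \bigcup_k G k.
  by rewrite -setI_bigcupr -seqDU_bigcup_eq UF setIT.
have GF k : G k `<=` F k by move=> x [_]; exact: subset_seqDU.
have tG : trivIset setT G.
  exact: trivIset_setIl (trivIset_seqDU F).
rewrite BG !ge0_integral_bigcup//.
by apply: eq_eseriesr => k _; exact: (FB k _ (GF k) (AG k)).
all: try by move=> k; exact/A_sub/AG.
all: try exact/measurable_EFinP/measurable_funTS.
all: by move=> x _; rewrite lee_fin.
Qed.

Lemma ae_bigcup (F : nat -> set X) (P : X -> Prop) : \bigcup_k F k = setT ->
  (forall k, \forall x \ae mu, F k x -> P x) -> \forall x \ae mu, P x.
Proof.
move=> UF /ae_foralln; apply: filterS => x Fx.
by have : [set: X] x by []; rewrite -UF => -[k _ /Fx].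
Qed.

(** The intended case: [r] is the real or imaginary part of a complex [f], [m] is |f|, and [s] is
    the same part of a conditional expectation of [f], tested only where |f| is integrable. *)
Context (m e r s : X -> R) (me : ge0_condexp m e).
Context (mr : measurable_fun setT r) (rm : forall x, `|r x| <= m x)
  (ms : measurable_fun setT (s : XA -> R))
  (rs : forall B, A B -> mu.-integrable B (EFin \o m) ->
    mu.-integrable B (EFin \o s) /\
    (\int[mu]_(x in B) (s x)%:E = \int[mu]_(x in B) (r x)%:E)%E).

Lemma integrable_dominated (B : set X) (h k v : X -> R) : measurable B ->
  measurable_fun setT h -> measurable_fun setT v ->
  (forall x, `|v x| <= k x) ->
  mu.-integrable B (fun x => (h x * k x)%:E) ->
  mu.-integrable B (fun x => (h x * v x)%:E).
Proof.
move=> mB mh mv vk; apply: le_integrable => //.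
  by apply/measurable_EFinP/measurable_funTS; exact: measurable_funM.
move=> x _ /=; rewrite lee_fin !normrM ler_wpM2l// (le_trans (vk x))//.
exact: ler_norm.
Qed.

(** On each piece of the exhaustion all integrals are finite, and integrating [- m <= r <= m] over
    members of the subalgebra compares [s] with [- e] and [e]. *)
Lemma norm_condexp_le : \forall x \ae mu, `|s x| <= e x.
Proof.
have [mm m0 meA e0 em] := me.
have [F [AF UF Fm Fe]] := ge0_condexp_exhaustion me.
apply: (ae_bigcup UF) => k; have mF := A_sub (AF k).
have rF B : A B -> B `<=` F k -> mu.-integrable B (EFin \o m) /\ mu.-integrable B (EFin \o r).
  move=> AB BF; have mB := A_sub AB.
  have mB' : mu.-integrable B (EFin \o m) by exact: (integrableS mF).
  split => //; apply: le_integrable mB' => //.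
    exact/measurable_EFinP/measurable_funTS.
  by move=> x _ /=; rewrite lee_fin (le_trans (rm x))// ler_norm.
have [sF _] := rs (AF k) (Fm k).
have s1 : \forall x \ae mu, F k x -> s x <= e x.
  apply: (le_ae_subalgebra A_sigma A_sub (AF k)) => // B BF AB.
  have [mB rB] := rF _ AB BF; have [_ ->] := rs AB mB.
  rewrite em//; apply: le_integral => //; first exact: A_sub.
  by move=> x _; rewrite lee_fin (le_trans (ler_norm _))//.
have s2 : \forall x \ae mu, F k x -> - e x <= s x.
  apply: (le_ae_subalgebra A_sigma A_sub (AF k)) => //.
  - by apply: measurableT_comp.
  - exact: (integrableN (Fe k)).
  move=> B BF AB; have [mB rB] := rF _ AB BF; have [_ ->] := rs AB mB.
  under eq_integral do rewrite EFinN.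
  rewrite integral_ge0N//; last by move=> x _; rewrite lee_fin.
  rewrite em// -integral_ge0N//; last by move=> x _; rewrite lee_fin.
  apply: le_integral => //; first exact: A_sub.
    exact: (integrableN mB).
  by move=> x _; rewrite lee_fin lerNl (le_trans _ (rm x))// -normrN ler_norm.
apply: filterS2 s1 s2 => x sx1 sx2 Fx.
by rewrite ler_norml sx1// sx2.
Qed.

(* Adding m to r makes the integrand nonnegative, so that the pull-out property
   for nonnegative functions applies to m + r and to m. *)
Lemma condexp_pull_out_ge0 (h : XA -> R) (B : set X) :
  measurable_fun setT h -> (forall x, 0 <= h x) -> A B ->
  mu.-integrable B (fun x => (h x * m x)%:E) ->
  mu.-integrable B (fun x => (h x * s x)%:E) /\
  (\int[mu]_(x in B) (h x * s x)%:E = \int[mu]_(x in B) (h x * r x)%:E)%E.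
Proof.
move=> mh h0 AB hm; have [mm m0 meA e0 em] := me; have mB := A_sub AB.
have mhX := measurable_fun_subalgebra A_sigma A_sub mh.
have meX := measurable_fun_subalgebra A_sigma A_sub meA.
have msX := measurable_fun_subalgebra A_sigma A_sub ms.
(* [e + s] is nonnegative only a.e., while [ge0_condexp] asks for nonnegativity everywhere; hence
   the absolute value. *)
pose p x := m x + r x; pose q x := `|e x + s x|.
have p0 x : 0 <= p x.
  by have := rm x; rewrite ler_norml -subr_ge0 opprK addrC => /andP[].
have qE : \forall x \ae mu, q x = e x + s x.
  apply: filterS norm_condexp_le => x; rewrite ler_norml => /andP[+ _].
  by rewrite -subr_ge0 opprK addrC /q => /ger0_norm.
have [F [AF UF Fm Fe]] := ge0_condexp_exhaustion me.
have pq : ge0_condexp p q.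
  apply: (@ge0_condexp_local p q F) => //.
  - exact: measurable_funD.
  - by apply: measurableT_comp => //; exact: measurable_funD.
  - by move=> x; exact: normr_ge0.
  move=> k C CF AC; have mC := A_sub AC; have mF := A_sub (AF k).
  have Cm : mu.-integrable C (EFin \o m) by exact: (integrableS mF).
  have Ce : mu.-integrable C (EFin \o e) by exact: (integrableS mF).
  have Cr : mu.-integrable C (EFin \o r).
    apply: le_integrable Cm => //; first exact/measurable_EFinP/measurable_funTS.
    by move=> x _ /=; rewrite lee_fin (le_trans (rm x))// ler_norm.
  have [Cs Csr] := rs AC Cm.
  transitivity (\int[mu]_(x in C) ((e x)%:E + (s x)%:E))%E.
    apply: ae_eq_integral => //.
    - apply/measurable_EFinP/measurable_funTS; apply: measurableT_comp => //.
      exact: measurable_funD.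
    - by apply: emeasurable_funD; exact/measurable_EFinP/measurable_funTS.
    - by apply: filterS qE => x -> _; rewrite EFinD.
  rewrite integralD_EFin// Csr em// -integralD_EFin//.
have [_ _ _ _ hpq] := ge0_condexpM A_sigma A_sub mh h0 pq.
have [_ _ _ _ hem] := ge0_condexpM A_sigma A_sub mh h0 me.
have hr : mu.-integrable B (fun x => (h x * r x)%:E).
  exact: integrable_dominated hm.
have he : mu.-integrable B (fun x => (h x * e x)%:E).
  apply/integrableP; split.
    by apply/measurable_EFinP/measurable_funTS; exact: measurable_funM.
  under eq_integral do rewrite /= ger0_norm ?mulr_ge0//.
  rewrite hem//; case/integrableP : hm => _.
  by under eq_integral do rewrite /= ger0_norm ?mulr_ge0//.
have hs : mu.-integrable B (fun x => (h x * s x)%:E).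
  apply/integrableP; split.
    by apply/measurable_EFinP/measurable_funTS; exact: measurable_funM.
  case/integrableP : he => _; apply: le_lt_trans.
  apply: ae_ge0_le_integral => //.
  - by apply: measurableT_comp => //; apply/measurable_EFinP/measurable_funTS;
      exact: measurable_funM.
  - by apply: measurableT_comp => //; apply/measurable_EFinP/measurable_funTS;
      exact: measurable_funM.
  apply: filterS norm_condexp_le => x sex _ /=.
  rewrite lee_fin !normrM ler_wpM2l// (le_trans sex)// ler_norm.
split => //.
have : (\int[mu]_(x in B) ((h x * e x)%:E + (h x * s x)%:E) =
        \int[mu]_(x in B) ((h x * m x)%:E + (h x * r x)%:E))%E.
  transitivity (\int[mu]_(x in B) (h x * q x)%:E)%E.
    apply: ae_eq_integral => //.
    - by apply: emeasurable_funD; apply/measurable_EFinP/measurable_funTS;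
        exact: measurable_funM.
    - apply/measurable_EFinP/measurable_funTS; apply: measurable_funM => //.
      by apply: measurableT_comp => //; exact: measurable_funD.
    - by apply: filterS qE => x -> _; rewrite mulrDr.
  by rewrite hpq//; apply: eq_integral => x _; rewrite -EFinD -mulrDr.
(* The integral of [h e] becomes that of [h m], which is finite and cancels. *)
rewrite !integralD_EFin// hem//; have fm := integrable_fin_num mB hm.
rewrite ![(\int[mu]_(x in B) (h x * m x)%:E + _)%E]addeC.
move=> /(congr1 (fun z => (z - \int[mu]_(x in B) (h x * m x)%:E)%E)).
by rewrite !addeK.
Qed.

Lemma condexp_pull_out_real (h : XA -> R) (B : set X) :
  measurable_fun setT h -> A B ->
  mu.-integrable B (fun x => (h x * m x)%:E) ->
  mu.-integrable B (fun x => (h x * s x)%:E) /\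
  (\int[mu]_(x in B) (h x * s x)%:E = \int[mu]_(x in B) (h x * r x)%:E)%E.
Proof.
move=> mh AB hm; have [mm m0 meA e0 em] := me; have mB := A_sub AB.
have hE x : h x = Num.max (h x) 0 - Num.max (- h x) 0.
  by case: (leP 0 (h x)) => h0; case: (leP 0 (- h x)) => h0'; lra.
have P (k : XA -> R) : measurable_fun setT k -> (forall x, `|k x| <= `|h x|) ->
    mu.-integrable B (fun x => (k x * m x)%:E).
  move=> mk kh; apply: le_integrable hm => //.
    apply/measurable_EFinP/measurable_funTS; apply: measurable_funM => //.
    exact: (measurable_fun_subalgebra A_sigma A_sub mk).
  by move=> x _ /=; rewrite lee_fin !normrM ler_wpM2r.
have mhp : measurable_fun setT (fun x => Num.max (h x) 0 : R).
  exact: measurable_maxr.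
have mhn : measurable_fun setT (fun x => Num.max (- h x) 0 : R).
  by apply: measurable_maxr => //; exact: measurableT_comp.
have hp : mu.-integrable B (fun x => (Num.max (h x) 0 * m x)%:E).
  by apply: P => // x; case: (leP 0 (h x)) => h0; rewrite ?normr0.
have hn : mu.-integrable B (fun x => (Num.max (- h x) 0 * m x)%:E).
  by apply: P => // x; case: (leP 0 (- h x)) => h0; rewrite ?normr0 ?normrN.
have [hps hpE] := condexp_pull_out_ge0 mhp (fun x => ltac:(by rewrite le_max lexx orbT)) AB hp.
have [hns hnE] := condexp_pull_out_ge0 mhn (fun x => ltac:(by rewrite le_max lexx orbT)) AB hn.
have E (v : X -> R) : (fun x => (h x * v x)%:E) =
    (fun x => (Num.max (h x) 0 * v x)%:E - (Num.max (- h x) 0 * v x)%:E)%E.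
  by apply/funext => x; rewrite [in LHS](hE x) mulrBl EFinB.
rewrite !E; split; first exact: integrableB.
have hpr : mu.-integrable B (fun x => (Num.max (h x) 0 * r x)%:E).
  apply: integrable_dominated hp => //.
  exact: (measurable_fun_subalgebra A_sigma A_sub mhp).
have hnr : mu.-integrable B (fun x => (Num.max (- h x) 0 * r x)%:E).
  apply: integrable_dominated hn => //.
  exact: (measurable_fun_subalgebra A_sigma A_sub mhn).
by rewrite !integralB_EFin// hpE hnE.
Qed.
End real_condexp.

(** The Radon-Nikodym derivative is taken with respect to a bundled sigma-finite measure; this
    attaches the structure to a measure that is sigma-finite by hypothesis. *)
Definition sigma_finite_pack d (T : measurableType d) (R : realType)
    (nu : {measure set T -> \bar R}) (nu_sf : sigma_finite setT nu) :
    {sigma_finite_measure set T -> \bar R} :=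
  HB.pack_for (SigmaFiniteMeasure.type T R) (Measure.sort nu)
    (isSFinite.Build _ T R nu (sfinite_measure_sigma_finite nu_sf))
    (isSigmaFinite.Build _ T R nu nu_sf).

(** * Existence through the Radon-Nikodym theorem *)

Section radon_nikodym_subalgebra.
Context d (X : measurableType d) (R : realType) (mu : {measure set X -> \bar R}).
Context (A : set (set X)) (A_sigma : sigma_algebra setT A)
  (A_sub : A `<=` measurable).
Local Notation XA := (g_sigma_algebraType A).
Context (A_sigma_finite : sigma_finite [set: XA] mu).

Let mid : measurable_fun setT (id : X -> XA).
Proof. exact: (measurable_fun_subalgebra A_sigma A_sub). Qed.

(** The restriction of [mu] to the subalgebra, obtained as its image under the identity map. *)
Let nu : {measure set XA -> \bar R}.
Proof. by refine (pushforward mu (id : X -> XA)); exact: mid. Defined.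

Let nu_sf : {sigma_finite_measure set XA -> \bar R}.
Proof. exact: (@sigma_finite_pack _ XA R nu A_sigma_finite). Defined.

(** [s] is the density, with respect to the restricted measure, of the charge sending [B] in the
    subalgebra to the integral of [r] over [B]. *)
Lemma real_condexp_exists (r : X -> R) : mu.-integrable setT (EFin \o r) ->
  exists2 s : X -> R, measurable_fun setT (s : XA -> R) & forall B, A B ->
    mu.-integrable B (EFin \o s) /\
    (\int[mu]_(x in B) (s x)%:E = \int[mu]_(x in B) (r x)%:E)%E.
Proof.
move=> ri.
have @la : {charge set XA -> \bar R}.
  by refine (pushforward (induced_charge ri) (id : X -> XA)); exact: mid.
have la_nu : la `<< nu_sf.
  apply/null_content_dominatesP => B mB muB0.
  apply: null_set_integral => //.
  - exact/A_sub/(subalgebra_measurable A_sigma).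
  - exact: measurable_funTS (measurable_int _ ri).
pose g := Radon_Nikodym la nu_sf.
have mg : measurable_fun setT g.
  exact: measurable_int (Radon_Nikodym_integrable la_nu).
have fing x : g x \is a fin_num by exact: Radon_Nikodym_fin_num.
have gE : EFin \o (fine \o g) = g by apply/funext => x /=; rewrite fineK.
have mgX : measurable_fun setT (g : X -> \bar R).
  exact: (measurable_fun_subalgebra A_sigma A_sub mg).
have gi : mu.-integrable setT g.
  have /integrableP[_ gfin] := Radon_Nikodym_integrable la_nu.
  apply/integrableP; split => //; apply: le_lt_trans gfin.
  rewrite (ge0_integral_pushforward mid)//.
  by apply: measurableT_comp.
exists (fine \o g); first exact: measurableT_comp.
move=> B AB; rewrite gE; split.
  by apply: integrableS gi => //; exact: A_sub.
under eq_integral do rewrite /= fineK//.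
have mB : measurable (B : set XA) by exact: measurable_subalgebra.
rewrite -[RHS]/(la B) (Radon_Nikodym_integral la_nu mB).
rewrite [RHS](integral_pushforward mid)//.
by apply: integrableS gi => //; exact: A_sub.
Qed.

Lemma ge0_condexp_exists (m : X -> R) : mu.-integrable setT (EFin \o m) ->
  (forall x, 0 <= m x) -> exists e, ge0_condexp mu A m e.
Proof.
move=> mi m0; have [s ms sm] := real_condexp_exists mi.
have msX := measurable_fun_subalgebra A_sigma A_sub ms.
have AT := subalgebraT A_sigma.
have [sT _] := sm _ AT.
have s0 : \forall x \ae mu, setT x -> 0 <= s x.
  apply: (le_ae_subalgebra A_sigma A_sub AT) => //.
    exact: integrable0.
  move=> B _ AB; have [_ ->] := sm _ AB; rewrite integral0.
  by apply: integral_ge0 => x _; rewrite lee_fin.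
(* The density is nonnegative only a.e.; the absolute value repairs the null set. *)
exists (fun x => `|s x|); split => //.
- by apply/measurable_EFinP; exact: measurable_int mi.
- by apply: measurableT_comp.
move=> B AB; have [_ <-] := sm _ AB.
apply: ae_eq_integral; first exact: A_sub.
- by apply/measurable_EFinP/measurable_funTS; exact: measurableT_comp.
- exact/measurable_EFinP/measurable_funTS.
- by apply: filterS s0 => x /(_ I) s0 _; rewrite ger0_norm.
Qed.
End radon_nikodym_subalgebra.

(** * Conditional expectations of complex functions *)

Section complex_modulus.
Context (R : realType).
Implicit Types z t : R[i].

Lemma normcE z : `|z| = (Normc.normc z)%:C%C.
Proof. by case: z. Qed.

Lemma normc_ge0 z : 0 <= Normc.normc z.
Proof. by case: z => a b; exact: sqrtr_ge0. Qed.

Lemma normc_Re z : `|complex.Re z| <= Normc.normc z.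
Proof.
by case: z => a b /=; rewrite -sqrtr_sqr ler_wsqrtr// lerDl sqr_ge0.
Qed.

Lemma normc_Im z : `|complex.Im z| <= Normc.normc z.
Proof.
by case: z => a b /=; rewrite -sqrtr_sqr ler_wsqrtr// lerDr sqr_ge0.
Qed.

Lemma normc_le z : Normc.normc z <= `|complex.Re z| + `|complex.Im z|.
Proof.
rewrite -(ler_pXn2r (n := 2))// ?nnegrE ?normc_ge0 ?addr_ge0//.
rewrite sqr_normcE -[complex.Re z ^+ 2]real_normK ?num_real//.
rewrite -[complex.Im z ^+ 2]real_normK ?num_real// sqrrD -addrA lerD2l.
by rewrite lerDr mulrn_wge0// mulr_ge0.
Qed.

Lemma Re_mulc z t : complex.Re (z * t) =
  complex.Re z * complex.Re t - complex.Im z * complex.Im t.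
Proof. by case: z => a b; case: t. Qed.

Lemma Im_mulc z t : complex.Im (z * t) =
  complex.Re z * complex.Im t + complex.Im z * complex.Re t.
Proof. by case: z => a b; case: t. Qed.

Lemma normc_conj z : Normc.normc z^* = Normc.normc z.
Proof. by case: z => a b /=; rewrite sqrrN. Qed.

Lemma mulc_conj z : z * z^* = (Normc.normc z ^+ 2)%:C%C.
Proof.
rewrite sqr_normcE; case: z => a b; apply/eqP.
by rewrite eq_complex /= mulrN opprK -!expr2 eqxx /= mulrN mulrC addNr.
Qed.

End complex_modulus.

(** * Measurability and integrability of complex functions *)

Section complex_measurability.
Context d (X : measurableType d) (R : realType).
Implicit Types f g h : X -> R[i].

Lemma cmeasurable_normc f : cmeasurable f ->
  measurable_fun setT (fun x => Normc.normc (f x)).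
Proof.
move=> [f1 f2].
rewrite (_ : (fun _ => _) =
  (@powR R ^~ 2^-1) \o
    (fun x => complex.Re (f x) ^+ 2 + complex.Im (f x) ^+ 2)); last first.
  apply/funext => x /=; rewrite powR12_sqrt ?addr_ge0 ?sqr_ge0//.
  by case: (f x).
apply: measurableT_comp => //.
by apply: measurable_funD; exact: measurable_funX.
Qed.

Lemma cmeasurable_cst (c : R[i]) : cmeasurable (fun _ : X => c).
Proof. by split. Qed.

Lemma cmeasurable_real (k : X -> R) : measurable_fun setT k ->
  cmeasurable (fun x => (k x)%:C%C).
Proof. by split. Qed.

Lemma cmeasurableM f g : cmeasurable f -> cmeasurable g ->
  cmeasurable (fun x => f x * g x).
Proof.
move=> [f1 f2] [g1 g2]; split.
  under eq_fun do rewrite Re_mulc.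
  by apply: measurable_funB; exact: measurable_funM.
under eq_fun do rewrite Im_mulc.
by apply: measurable_funD; exact: measurable_funM.
Qed.

Lemma cmeasurableD f g : cmeasurable f -> cmeasurable g ->
  cmeasurable (fun x => f x + g x).
Proof.
move=> [f1 f2] [g1 g2]; split.
  rewrite (_ : (fun _ => _) = fun x => complex.Re (f x) + complex.Re (g x)).
    exact: measurable_funD.
  by apply/funext => x; case: (f x); case: (g x).
rewrite (_ : (fun _ => _) = fun x => complex.Im (f x) + complex.Im (g x)).
  exact: measurable_funD.
by apply/funext => x; case: (f x); case: (g x).
Qed.

Lemma cmeasurable_conj f : cmeasurable f -> cmeasurable (fun x => (f x)^*).
Proof.
move=> [f1 f2]; split.
  by rewrite (_ : (fun _ => _) = fun x => complex.Re (f x))//;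
    apply/funext => x; case: (f x).
rewrite (_ : (fun _ => _) = fun x => - complex.Im (f x)).
  exact: measurableT_comp.
by apply/funext => x; case: (f x).
Qed.

(** Rests on [f^-1 = |f|^-2 conj f], valid also at the zeros of [f] because [0^-1 = 0]. *)
Lemma cmeasurableV f : cmeasurable f -> cmeasurable (fun x => (f x)^-1).
Proof.
move=> mf; rewrite (_ : (fun _ => _) =
    fun x => ((Normc.normc (f x) ^+ 2)^-1)%:C%C * (f x)^*).
  apply: cmeasurableM; last exact: cmeasurable_conj.
  apply: cmeasurable_real.
  rewrite (_ : (fun _ => _) =
    (@powR R ^~ (-1)) \o (fun x => Normc.normc (f x) ^+ 2)); last first.
    by apply/funext => x /=; rewrite powR_inv1 ?sqr_ge0.
  apply: measurableT_comp => //.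
  exact: measurable_funX (cmeasurable_normc mf).
apply/funext => x; have [->|f0] := eqVneq (f x) 0.
  by rewrite invr0 rmorph0 mulr0.
rewrite fmorphV/= -mulc_conj invfM mulrAC -mulrA divff ?mulr1//.
by rewrite conjC_eq0.
Qed.

Lemma cmeasurableX f n : cmeasurable f -> cmeasurable (fun x => f x ^+ n).
Proof.
move=> mf; elim: n => [|n IH]; first exact: cmeasurable_cst.
by under eq_fun do rewrite exprS; exact: cmeasurableM.
Qed.

Context (mu : {measure set X -> \bar R}).

Lemma cintegrable_normc f (B : set X) : measurable B -> cmeasurable f ->
  cintegrable mu B f <-> mu.-integrable B (fun x => (Normc.normc (f x))%:E).
Proof.
move=> mB mf; have [f1 f2] := mf; have mn := cmeasurable_normc mf; split.
  move=> [i1 i2]; have := integrableD mB (integrable_abse i1) (integrable_abse i2).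
  apply: le_integrable => //; first exact/measurable_EFinP/measurable_funTS.
  move=> x _ /=; rewrite lee_fin (ger0_norm (normc_ge0 _)).
  by rewrite (le_trans (normc_le _))// ler_norm.
move=> i; split; apply: le_integrable i => //.
- exact/measurable_EFinP/measurable_funTS.
- move=> x _ /=; rewrite lee_fin (le_trans (normc_Re _))// ler_norm//.
- exact/measurable_EFinP/measurable_funTS.
- move=> x _ /=; rewrite lee_fin (le_trans (normc_Im _))// ler_norm//.
Qed.

End complex_measurability.

(** * Pull-out and uniqueness for complex functions *)

Section complex_condexp.
Context d (X : measurableType d) (R : realType) (mu : {measure set X -> \bar R}).
Context (A : set (set X)) (A_sigma : sigma_algebra setT A)
  (A_sub : A `<=` measurable).
Local Notation XA := (g_sigma_algebraType A).
Context (A_sigma_finite : sigma_finite [set: XA] mu).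
Implicit Types f g h : X -> R[i].

Lemma cmeasurable_subalgebra f : @cmeasurable _ XA R f -> cmeasurable f.
Proof.
move=> [f1 f2]; split.
  exact: (measurable_fun_subalgebra A_sigma A_sub f1).
exact: (measurable_fun_subalgebra A_sigma A_sub f2).
Qed.

(** E|f| may be infinite on a null set; [fine] puts 0 there and leaves the integrals unchanged. *)
Lemma is_condexp_normc f g : cmeasurable f -> is_condexp mu A f g ->
  exists e, ge0_condexp mu A (fun x => Normc.normc (f x)) e.
Proof.
move=> mf [[e [e0 me ef] efin] _ _]; exists (fine \o e); split.
- exact: cmeasurable_normc.
- by move=> x; exact: normc_ge0.
- exact: measurableT_comp.
- by move=> x; rewrite fine_ge0.
move=> B AB; rewrite -ef//.
have meX : measurable_fun setT e.
  exact: (measurable_fun_subalgebra A_sigma A_sub me).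
apply: ae_eq_integral.
- exact: A_sub.
- by apply/measurable_EFinP/measurable_funTS; exact: measurableT_comp.
- exact: measurable_funTS.
- by apply: filterS efin => x ex _ /=; rewrite fineK// ge0_fin_numE.
Qed.

Lemma ge0_condexp_is_condexp f g e :
  ge0_condexp mu A (fun x => Normc.normc (f x)) e ->
  @cmeasurable _ XA R g ->
  (forall B, A B -> cintegrable mu B f ->
    cintegrable mu B g /\ cintegral mu B g = cintegral mu B f) ->
  is_condexp mu A f g.
Proof.
move=> [_ _ me e0 em] mg fg; split => //.
exists (EFin \o e); last by apply: aeW => x; rewrite /= ltry.
by split => //; exact/measurable_EFinP.
Qed.

(** [cintegral] is made of [fine] values; integrability lifts the equalities back to extended real
    integrals. *)
Lemma is_condexp_parts f g (B : set X) : cmeasurable f -> is_condexp mu A f g ->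
  A B -> mu.-integrable B (fun x => (Normc.normc (f x))%:E) ->
  [/\ mu.-integrable B (fun x => (complex.Re (g x))%:E),
      mu.-integrable B (fun x => (complex.Im (g x))%:E),
      (\int[mu]_(x in B) (complex.Re (g x))%:E =
        \int[mu]_(x in B) (complex.Re (f x))%:E)%E &
      (\int[mu]_(x in B) (complex.Im (g x))%:E =
        \int[mu]_(x in B) (complex.Im (f x))%:E)%E].
Proof.
move=> mf [_ _ fg] AB; have mB := A_sub AB.
move=> /(cintegrable_normc mu mB mf) iB.
have [iB1 iB2] := iB; have [[ig1 ig2] [e1 e2]] := fg B AB iB.
have E (a b : X -> R) : mu.-integrable B (EFin \o a) -> mu.-integrable B (EFin \o b) ->
    \int[mu]_(x in B) (a x) = \int[mu]_(x in B) (b x) ->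
    (\int[mu]_(x in B) (a x)%:E = \int[mu]_(x in B) (b x)%:E)%E.
  move=> ia ib ab; rewrite -[LHS]fineK ?integrable_fin_num//.
  by rewrite -[RHS]fineK ?integrable_fin_num//; congr (_%:E).
by split => //; exact: E.
Qed.

(** [h] may be unbounded, and [f] need not be integrable on a set where [h f] is: |h| E|f| is a
    finite version of E|h f|, and the complex product splits into four real ones, each pulled out
    with dominating function |f|. *)
Lemma is_condexp_pull_out f g h : cmeasurable f -> is_condexp mu A f g ->
  @cmeasurable _ XA R h -> is_condexp mu A (fun x => h x * f x) (fun x => h x * g x).
Proof.
move=> mf fg mh; have [e fe] := is_condexp_normc mf fg.
have mhX := cmeasurable_subalgebra mh; have [h1 h2] := mh.
have [_ [g1 g2] _] := fg; have [f1 f2] := mf.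
have hfe := ge0_condexpM A_sigma A_sub (cmeasurable_normc mh)
  (fun x => normc_ge0 (h x)) fe.
apply: (@ge0_condexp_is_condexp _ _ (fun x => Normc.normc (h x) * e x)).
- move: hfe; rewrite (_ : (fun x => _ * Normc.normc _) =
    (fun x => Normc.normc (h x * f x)))//.
  by apply/funext => x; rewrite Normc.normcM.
- by apply: cmeasurableM => //; split.
move=> B AB; have mB := A_sub AB.
move=> /(cintegrable_normc mu mB (cmeasurableM mhX mf)) hfi.
have P (k : X -> R) (r s : X -> R) : measurable_fun setT (k : XA -> R) ->
    (forall x, `|k x| <= Normc.normc (h x)) ->
    measurable_fun setT r -> (forall x, `|r x| <= Normc.normc (f x)) ->
    measurable_fun setT (s : XA -> R) ->
    (forall B, A B -> mu.-integrable B (fun x => (Normc.normc (f x))%:E) ->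
      mu.-integrable B (EFin \o s) /\
      (\int[mu]_(x in B) (s x)%:E = \int[mu]_(x in B) (r x)%:E)%E) ->
    [/\ mu.-integrable B (fun x => (k x * s x)%:E),
        mu.-integrable B (fun x => (k x * r x)%:E) &
        \int[mu]_(x in B) (k x * s x) = \int[mu]_(x in B) (k x * r x)].
  move=> mk kh mr rf ms rs.
  have mkX := measurable_fun_subalgebra A_sigma A_sub mk.
  have ki : mu.-integrable B (fun x => (k x * Normc.normc (f x))%:E).
    apply: le_integrable hfi => //.
      apply/measurable_EFinP/measurable_funTS; apply: measurable_funM => //.
      exact: cmeasurable_normc.
    move=> x _ /=; rewrite lee_fin Normc.normcM !normrM ler_wpM2r//.
    by rewrite [leRHS]ger0_norm ?normc_ge0.
  have [i1 eq1] := condexp_pull_out_real A_sigma A_sub A_sigma_finite fe mr rf ms rs mk AB ki.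
  split => //; last by rewrite /Rintegral eq1.
  exact: (integrable_dominated mB mkX mr rf ki).
have Re_rs B' : A B' -> mu.-integrable B' (fun x => (Normc.normc (f x))%:E) ->
    mu.-integrable B' (EFin \o (fun x => complex.Re (g x))) /\
    (\int[mu]_(x in B') (complex.Re (g x))%:E =
     \int[mu]_(x in B') (complex.Re (f x))%:E)%E.
  by move=> AB' iB'; have [] := is_condexp_parts mf fg AB' iB'.
have Im_rs B' : A B' -> mu.-integrable B' (fun x => (Normc.normc (f x))%:E) ->
    mu.-integrable B' (EFin \o (fun x => complex.Im (g x))) /\
    (\int[mu]_(x in B') (complex.Im (g x))%:E =
     \int[mu]_(x in B') (complex.Im (f x))%:E)%E.
  by move=> AB' iB'; have [] := is_condexp_parts mf fg AB' iB'.
have [iRR jRR eRR] := P _ _ _ h1 (fun x => normc_Re _) f1 (fun x => normc_Re _) g1 Re_rs.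
have [iRI jRI eRI] := P _ _ _ h1 (fun x => normc_Re _) f2 (fun x => normc_Im _) g2 Im_rs.
have [iIR jIR eIR] := P _ _ _ h2 (fun x => normc_Im _) f1 (fun x => normc_Re _) g1 Re_rs.
have [iII jII eII] := P _ _ _ h2 (fun x => normc_Im _) f2 (fun x => normc_Im _) g2 Im_rs.
split.
  split.
    under eq_fun do rewrite Re_mulc EFinB.
    exact: integrableB.
  under eq_fun do rewrite Im_mulc EFinD.
  exact: integrableD.
rewrite /cintegral; congr Complex.
  under eq_Rintegral do rewrite Re_mulc.
  under [RHS]eq_Rintegral do rewrite Re_mulc.
  by rewrite !RintegralB// eRR eII.
under eq_Rintegral do rewrite Im_mulc.
under [RHS]eq_Rintegral do rewrite Im_mulc.
by rewrite !RintegralD// eRI eIR.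
Qed.

(** The exhaustion attached to E|f| consists of members of the subalgebra on which [f] is
    integrable, so both defining identities apply there and the parts can be compared. *)
Lemma is_condexp_unique f g1 g2 : cmeasurable f ->
  is_condexp mu A f g1 -> is_condexp mu A f g2 -> \forall x \ae mu, g1 x = g2 x.
Proof.
move=> mf fg1 fg2; have [e fe] := is_condexp_normc mf fg1.
have [F [AF UF Fm _]] := ge0_condexp_exhaustion A_sigma A_sub A_sigma_finite fe.
have [_ [g11 g12] _] := fg1; have [_ [g21 g22] _] := fg2.
have iF k B : B `<=` F k -> A B ->
    mu.-integrable B (fun x => (Normc.normc (f x))%:E).
  by move=> BF AB; apply: (integrableS _ _ BF (Fm k)); exact: A_sub.
apply: (ae_bigcup UF) => k.
have [i11 i12 _ _] := is_condexp_parts mf fg1 (AF k) (Fm k).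
have [i21 i22 _ _] := is_condexp_parts mf fg2 (AF k) (Fm k).
have LE (s t : X -> R) : measurable_fun setT (s : XA -> R) ->
    measurable_fun setT (t : XA -> R) ->
    mu.-integrable (F k) (EFin \o s) -> mu.-integrable (F k) (EFin \o t) ->
    (forall B, B `<=` F k -> A B ->
      (\int[mu]_(x in B) (s x)%:E = \int[mu]_(x in B) (t x)%:E)%E) ->
    \forall x \ae mu, F k x -> s x = t x.
  move=> ms mt si ti st.
  have st1 := le_ae_subalgebra A_sigma A_sub (AF k) ms mt si ti.
  have ts1 := le_ae_subalgebra A_sigma A_sub (AF k) mt ms ti si.
  apply: filterS2 (st1 _) (ts1 _) => [x sx tx Fx|B BF AB|B BF AB].
  - by apply/eqP; rewrite eq_le sx// tx.
  - by rewrite st.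
  - by rewrite st.
have RE : \forall x \ae mu, F k x -> complex.Re (g1 x) = complex.Re (g2 x).
  apply: LE => // B BF AB.
  have [_ _ -> _] := is_condexp_parts mf fg1 AB (iF k B BF AB).
  by have [_ _ -> _] := is_condexp_parts mf fg2 AB (iF k B BF AB).
have IM : \forall x \ae mu, F k x -> complex.Im (g1 x) = complex.Im (g2 x).
  apply: LE => // B BF AB.
  have [_ _ _ ->] := is_condexp_parts mf fg1 AB (iF k B BF AB).
  by have [_ _ _ ->] := is_condexp_parts mf fg2 AB (iF k B BF AB).
apply: filterS2 RE IM => x rx ix Fx; move: (rx Fx) (ix Fx).
by case: (g1 x) (g2 x) => [a b] [a' b'] /= -> ->.
Qed.

Lemma is_condexp_ae f f' g : cmeasurable f -> cmeasurable f' ->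
  (\forall x \ae mu, f x = f' x) -> is_condexp mu A f g -> is_condexp mu A f' g.
Proof.
move=> mf mf' ff' fg; have [e [_ _ me e0 fe]] := is_condexp_normc mf fg.
have [_ mg _] := fg.
apply: (@ge0_condexp_is_condexp _ _ e) => //.
  split => //; first exact: cmeasurable_normc.
    by move=> x; exact: normc_ge0.
  move=> B AB; rewrite fe//; apply: ae_eq_integral; first exact: A_sub.
  - by apply/measurable_EFinP/measurable_funTS; exact: cmeasurable_normc.
  - by apply/measurable_EFinP/measurable_funTS; exact: cmeasurable_normc.
  - by apply: filterS ff' => x -> _.
have [f1 f2] := mf; have [f1' f2'] := mf'.
move=> B AB [if1 if2]; have mB := A_sub AB.
have E (a b : X -> R) : measurable_fun setT a -> measurable_fun setT b ->
    (\forall x \ae mu, a x = b x) ->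
    mu.-integrable B (fun x => (b x)%:E) ->
    mu.-integrable B (fun x => (a x)%:E) /\
    \int[mu]_(x in B) a x = \int[mu]_(x in B) b x.
  move=> ma mb ab; have ab' : ae_eq mu B (EFin \o b) (EFin \o a).
    by apply: filterS ab => x /= -> _.
  have mbB : measurable_fun B (EFin \o b) by exact/measurable_EFinP/measurable_funTS.
  have maB : measurable_fun B (EFin \o a) by exact/measurable_EFinP/measurable_funTS.
  move=> /integrableP[_ ib]; split.
    apply/integrableP; split => //; move: ib; congr (_ < _)%E.
    apply: ae_eq_integral => //; try exact: measurableT_comp.
    by apply: filterS ab' => x abx /abx /= [->].
  by congr fine; apply/esym/ae_eq_integral.
have ffc (p : R[i] -> R) : \forall x \ae mu, p (f x) = p (f' x).
  by apply: filterS ff' => x ->.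
have [if1' e1] := E _ _ f1 f1' (ffc _) if1.
have [if2' e2] := E _ _ f2 f2' (ffc _) if2.
have [_ _ fg'] := fg; have [ig eg] := fg' B AB (conj if1' if2').
by split => //; rewrite eg /cintegral e1 e2.
Qed.

Lemma is_condexp_exists f : cintegrable mu setT f -> exists g, is_condexp mu A f g.
Proof.
move=> fi; have mf := cintegrable_cmeasurable fi; have [f1 f2] := fi.
have [s1 ms1 sf1] := real_condexp_exists A_sigma A_sub A_sigma_finite f1.
have [s2 ms2 sf2] := real_condexp_exists A_sigma A_sub A_sigma_finite f2.
have ni := (cintegrable_normc mu measurableT mf).1 fi.
have [e fe] := ge0_condexp_exists A_sigma A_sub A_sigma_finite ni (fun x => normc_ge0 _).
exists (fun x => Complex (s1 x) (s2 x)); apply: ge0_condexp_is_condexp fe _ _ => //.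
move=> B AB _; have [i1 e1] := sf1 B AB; have [i2 e2] := sf2 B AB.
by split => //; rewrite /cintegral /Rintegral e1 e2.
Qed.

Lemma condexp_is_condexp f g : is_condexp mu A f g ->
  is_condexp mu A f (condexp mu A f).
Proof. by move=> fg; apply: xgetPex; exists g. Qed.

Lemma condexp_ae f g : cmeasurable f -> is_condexp mu A f g ->
  \forall x \ae mu, condexp mu A f x = g x.
Proof.
by move=> mf fg; exact: (is_condexp_unique mf (condexp_is_condexp fg) fg).
Qed.

End complex_condexp.

(** * The space L^2 *)

Section L2_space.
Context d (X : measurableType d) (R : realType) (mu : {measure set X -> \bar R}).
Implicit Types (f g h : X -> R[i]) (x y : L2 mu).
Local Notation nc := Normc.normc.

Lemma L2funE f : (f \in L2fun mu) <->
  cmeasurable f /\ (\int[mu]_t (nc (f t) ^+ 2)%:E < +oo)%E.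
Proof.
rewrite inE; split=> -[mf]; first by move/finite_norm2E.
by move=> fi; split => //; exact/finite_norm2E.
Qed.

Lemma L2fun_le (k : X -> R) f : cmeasurable f -> measurable_fun setT k ->
  (\int[mu]_t (k t ^+ 2)%:E < +oo)%E -> (forall t, nc (f t) <= k t) ->
  f \in L2fun mu.
Proof.
move=> mf mk ki fk; apply/L2funE; split => //; apply: le_lt_trans ki.
apply: ge0_le_integral => //.
- by move=> t _; rewrite lee_fin sqr_ge0.
- by apply/measurable_EFinP; apply: measurable_funX; exact: cmeasurable_normc.
- by apply/measurable_EFinP; exact: measurable_funX.
- move=> t _; rewrite lee_fin ler_pXn2r// nnegrE ?normc_ge0//.
  exact: le_trans (normc_ge0 _) (fk t).
Qed.

Lemma L2fun_bounded_mul h f (c : R) : cmeasurable h -> (forall t, nc (h t) <= c) ->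
  f \in L2fun mu -> (fun t => h t * f t) \in L2fun mu.
Proof.
move=> mh hc /L2funE[mf fi].
apply: (@L2fun_le (fun t => c * nc (f t))); first exact: cmeasurableM.
- by apply: measurable_funM => //; exact: cmeasurable_normc.
- have mf2 : measurable_fun setT (fun t => (nc (f t) ^+ 2)%:E).
    by apply/measurable_EFinP; apply: measurable_funX; exact: cmeasurable_normc.
  under eq_integral do rewrite exprMn EFinM.
  rewrite ge0_integralZl//.
  - by rewrite lte_mul_pinfty// lee_fin sqr_ge0.
  - by move=> t _; rewrite lee_fin sqr_ge0.
  - by rewrite lee_fin sqr_ge0.
- by move=> t; rewrite Normc.normcM ler_wpM2r ?normc_ge0.
Qed.

Lemma L2_class_repr f : f \in L2fun mu ->
  \forall t \ae mu, repr (L2class mu f) t = f t.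
Proof.
move=> fL; apply: filterS (L2_repr (insubd (0 : L2funType mu) f)) => t ->.
have := insubdK (0 : L2funType mu) fL.
by move=> /(congr1 (fun k : X -> R[i] => k t)).
Qed.

Lemma L2_aeP x y : (\forall t \ae mu, repr x t = repr y t) -> x = y.
Proof. by move=> xy; rewrite -(reprK x) -(reprK y); apply/L2_eqP. Qed.

Lemma L2_reprD x y : \forall t \ae mu, repr (x + y) t = repr x t + repr y t.
Proof.
have := L2_repr (repr x + repr y).
by rewrite Quotient.pi_add !reprK.
Qed.

Lemma L2_reprZ (c : R[i]) x : \forall t \ae mu, repr (c *: x) t = c * repr x t.
Proof. exact: L2_repr (c *: repr x). Qed.

Lemma L2_repr0 : \forall t \ae mu, repr (0 : L2 mu) t = 0.
Proof.
have := L2_repr (0 : L2funType mu).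
by rewrite -[in X in _ -> X](raddf0 \pi_(L2 mu)%qT).
Qed.

Lemma repr_L2fun x : (repr x : X -> R[i]) \in L2fun mu.
Proof. exact: L2valP. Qed.

Lemma repr_cmeasurable x : cmeasurable (repr x).
Proof. by have /L2funE[] := repr_L2fun x. Qed.

Lemma L2ip_normE x : L2ip mu x x = (\int[mu]_t (nc (repr x t) ^+ 2))%:C%C.
Proof.
rewrite /L2ip (eq_cintegral _ _ (fun t => mulc_conj (repr x t))) /cintegral /=.
by rewrite Rintegral_cst// mul0r.
Qed.

Lemma hnormE x : hnorm (L2ip mu) x = Num.sqrt (complex.Re (L2ip mu x x)).
Proof. by []. Qed.

Lemma sqr_hnorm x : hnorm (L2ip mu) x ^+ 2 = \int[mu]_t (nc (repr x t) ^+ 2).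
Proof.
by rewrite hnormE L2ip_normE sqr_sqrtr//=; apply: Rintegral_ge0 => t _; rewrite sqr_ge0.
Qed.

Lemma hnorm_ge0 x : 0 <= hnorm (L2ip mu) x.
Proof. exact: sqrtr_ge0. Qed.

Lemma L2ip_hnorm x : L2ip mu x x = (hnorm (L2ip mu) x ^+ 2)%:C%C.
Proof. by rewrite sqr_hnorm L2ip_normE. Qed.

Lemma measurable_sqr_normc x :
  measurable_fun setT (fun t : X => (nc (repr x t) ^+ 2)%:E).
Proof.
apply/measurable_EFinP; apply: measurable_funX.
exact: cmeasurable_normc (repr_cmeasurable x).
Qed.

Lemma integral_sqr_normc x :
  (\int[mu]_t (nc (repr x t) ^+ 2)%:E)%E = (hnorm (L2ip mu) x ^+ 2)%:E.
Proof.
rewrite sqr_hnorm fineK// ge0_fin_numE; first by have /L2funE[] := repr_L2fun x.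
by apply: integral_ge0 => t _; rewrite lee_fin sqr_ge0.
Qed.

Lemma hnorm_le (c : R) x y : 0 <= c ->
  (\forall t \ae mu, nc (repr x t) <= c * nc (repr y t)) ->
  hnorm (L2ip mu) x <= c * hnorm (L2ip mu) y.
Proof.
move=> c0 xy; rewrite -(ler_pXn2r (n := 2))// ?nnegrE ?mulr_ge0 ?hnorm_ge0//.
have mnc := measurable_sqr_normc.
rewrite exprMn -lee_fin [X in (_ <= X)%E]EFinM -!integral_sqr_normc.
rewrite -ge0_integralZl//; last 2 first.
- by move=> t _; rewrite lee_fin sqr_ge0.
- by rewrite lee_fin sqr_ge0.
apply: ae_ge0_le_integral => //.
- by move=> t _; rewrite lee_fin sqr_ge0.
- by move=> t _; rewrite mule_ge0// lee_fin sqr_ge0.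
- exact: measurable_funeM.
apply: filterS xy => t xyt _; rewrite -EFinM lee_fin -exprMn.
by rewrite ler_pXn2r// ?nnegrE ?mulr_ge0 ?normc_ge0.
Qed.

Lemma hnorm_le0 x : hnorm (L2ip mu) x <= 0 -> x = 0.
Proof.
move=> x0; apply/eqP; apply: contraTT isT => /(L2ip_gt0); rewrite L2ip_hnorm.
have -> : hnorm (L2ip mu) x = 0 by apply/eqP; rewrite eq_le x0 hnorm_ge0.
by rewrite expr0n/= ltxx.
Qed.

Lemma hnorm0 : hnorm (L2ip mu) (0 : L2 mu) = 0.
Proof. by rewrite hnormE linear0l/= sqrtr0. Qed.

(** Expansion of |x - c y|^2 >= 0. The free constant [c] serves to absorb a multiple of |x|^2 when
    the adjoint is built. *)
Lemma L2ip_le x y (c : R) : 2 * c * complex.Re (L2ip mu x y) <=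
  hnorm (L2ip mu) x ^+ 2 + c ^+ 2 * hnorm (L2ip mu) y ^+ 2.
Proof.
have E z : hnorm (L2ip mu) z ^+ 2 = complex.Re (L2ip mu z z).
  by rewrite L2ip_hnorm.
have := sqr_ge0 (hnorm (L2ip mu) (x + (- c)%:C%C *: y)).
have DL a b z : L2ip mu (a + b) z = L2ip mu a z + L2ip mu b z by exact: linearDl.
have DR a b z : L2ip mu z (a + b) = L2ip mu z a + L2ip mu z b by exact: linearDr.
have ZL (k : R[i]) a z : L2ip mu (k *: a) z = k * L2ip mu a z by exact: linearZl_LR.
have ZR (k : R[i]) a z : L2ip mu z (k *: a) = k^* * L2ip mu z a by exact: linearZr_LR.
rewrite !E !DL !DR !ZL !ZR (L2ip_conj y x).
move: (L2ip mu x x) (L2ip mu x y) (L2ip mu y y).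
by move=> [? ?] [? ?] [? ?] /=; clear; lra.
Qed.

Lemma hnormZ (c : R[i]) x :
  hnorm (L2ip mu) (c *: x) = nc c * hnorm (L2ip mu) x.
Proof.
apply/eqP; rewrite -(eqrXn2 (n := 2))// ?mulr_ge0 ?normc_ge0 ?hnorm_ge0//.
have ZL (k : R[i]) a z : L2ip mu (k *: a) z = k * L2ip mu a z by exact: linearZl_LR.
have ZR (k : R[i]) a z : L2ip mu z (k *: a) = k^* * L2ip mu z a by exact: linearZr_LR.
apply/eqP; have := L2ip_hnorm (c *: x).
rewrite ZL ZR mulrA mulc_conj L2ip_hnorm -rmorphM exprMn.
by move=> /(congr1 (@complex.Re R)) /= <-.
Qed.

(** The parallelogram law bounds |x + y|^2 by 2 (|x|^2 + |y|^2). The factor 2 is harmless: only the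
    boundedness of a resolvent is derived from it. *)
Lemma hnormD x y :
  hnorm (L2ip mu) (x + y) <= 2 * (hnorm (L2ip mu) x + hnorm (L2ip mu) y).
Proof.
set a := hnorm _ x; set b := hnorm _ y.
have a0 : 0 <= a := hnorm_ge0 x; have b0 : 0 <= b := hnorm_ge0 y.
have : hnorm (L2ip mu) (x + y) ^+ 2 + hnorm (L2ip mu) (x - y) ^+ 2 =
    2 * (a ^+ 2 + b ^+ 2).
  have E z : hnorm (L2ip mu) z ^+ 2 = complex.Re (L2ip mu z z).
    by rewrite L2ip_hnorm.
  have DL u v z : L2ip mu (u + v) z = L2ip mu u z + L2ip mu v z by exact: linearDl.
  have DR u v z : L2ip mu z (u + v) = L2ip mu z u + L2ip mu z v by exact: linearDr.
  have NL u z : L2ip mu (- u) z = - L2ip mu u z by exact: linearNl.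
  have NR u z : L2ip mu z (- u) = - L2ip mu z u by exact: linearNr.
  rewrite /a /b !E !DL !DR !NL !NR.
  move: (L2ip mu x x) (L2ip mu x y) (L2ip mu y x) (L2ip mu y y).
  by move=> [? ?] [? ?] [? ?] [? ?] /=; clear; lra.
have c0 := sqr_ge0 (hnorm (L2ip mu) (x - y)).
move=> E; rewrite -(ler_pXn2r (n := 2))// ?nnegrE ?mulr_ge0 ?addr_ge0 ?hnorm_ge0//.
move: (hnorm _ (x + y)) (hnorm _ (x - y)) E c0 => s t E c0.
have ab : 0 <= a * b by exact: mulr_ge0.
clearbody a b; clear -E c0 ab; nra.
Qed.

(** Meant for bounded [h]: a product outside L^2 is sent to 0 by [L2class]. *)
Definition L2mul h x : L2 mu := L2class mu (fun t => h t * repr x t).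

Lemma L2_mul_repr h (c : R) x : cmeasurable h -> (forall t, nc (h t) <= c) ->
  \forall t \ae mu, repr (L2mul h x) t = h t * repr x t.
Proof.
move=> mh hc; apply: L2_class_repr.
exact: (L2fun_bounded_mul mh hc (repr_L2fun x)).
Qed.

Lemma L2mul_linear h (c : R) : cmeasurable h -> (forall t, nc (h t) <= c) ->
  linear (L2mul h).
Proof.
move=> mh hc k x y; apply: L2_aeP; have E x := L2_mul_repr x mh hc.
have E1 : \forall t \ae mu, repr (L2mul h (k *: x + y)) t =
    h t * (k * repr x t + repr y t).
  by apply: filterS3 (E (k *: x + y)) (L2_reprD (k *: x) y) (L2_reprZ k x)
    => t -> -> ->.
have E2 : \forall t \ae mu, repr (k *: L2mul h x + L2mul h y) t =
    k * repr (L2mul h x) t + repr (L2mul h y) t.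
  by apply: filterS2 (L2_reprD (k *: L2mul h x) (L2mul h y))
    (L2_reprZ k (L2mul h x)) => t -> ->.
apply: filterS2 E1 _ => [t ->|]; last first.
  by apply: filterS3 E2 (E x) (E y) => t; exact: (fun p q r => And3 p q r).
by move=> [-> -> ->]; rewrite mulrDr mulrCA.
Qed.

Lemma hnorm_L2mul h (c : R) x : cmeasurable h -> 0 <= c ->
  (forall t, nc (h t) <= c) ->
  hnorm (L2ip mu) (L2mul h x) <= c * hnorm (L2ip mu) x.
Proof.
move=> mh c0 hc; apply: hnorm_le => //.
apply: filterS (L2_mul_repr x mh hc) => t ->.
by rewrite Normc.normcM ler_wpM2r ?normc_ge0.
Qed.

End L2_space.

(** * Weighted conditional type operators *)

Section WCT_operator.
Context d (X : measurableType d) (R : realType) (mu : {measure set X -> \bar R}).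
Context (A : set (set X)) (A_sigma : sigma_algebra setT A)
  (A_sub : A `<=` measurable).
Local Notation XA := (g_sigma_algebraType A).
Context (A_sigma_finite : sigma_finite [set: XA] mu).
Context (u w : X -> R[i]) (uw : WCT_weights mu A u w).
Local Notation nc := Normc.normc.
Local Notation T := (WCT mu A u w).
Local Notation phi := (condexp mu A (fun t => u t * w t)).
Implicit Types (f g h : X -> R[i]) (x y : L2 mu).

Let measurable_u : cmeasurable u. Proof. by case: uw. Qed.
Let measurable_w : cmeasurable w. Proof. by case: uw. Qed.

Lemma is_condexp0 : is_condexp mu A (cst 0) (cst 0).
Proof.
apply: (@ge0_condexp_is_condexp _ _ _ _ _ _ _ (cst 0)).
- split => //; first by move=> t; exact: normc_ge0.
  by move=> B _; apply: eq_integral => t _; rewrite Normc.normc0.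
- exact: cmeasurable_cst.
- by [].
Qed.

(** [h g] is a conditional expectation of [h f], which vanishes a.e. and so also has 0 as one. *)
Lemma is_condexp_pull_out0 f g h : cmeasurable f -> is_condexp mu A f g ->
  @cmeasurable _ XA R h -> (\forall t \ae mu, h t * f t = 0) ->
  \forall t \ae mu, h t * g t = 0.
Proof.
move=> mf fg mh hf0; have mhX := cmeasurable_subalgebra A_sigma A_sub mh.
have hfg := is_condexp_pull_out A_sigma A_sub A_sigma_finite mf fg mh.
have mhf := cmeasurableM mhX mf.
have := is_condexp_ae A_sigma A_sub mhf (@cmeasurable_cst _ X R 0) hf0 hfg.
move=> /(is_condexp_unique A_sigma A_sub A_sigma_finite (@cmeasurable_cst _ X R 0)).
by apply; exact: is_condexp0.
Qed.

Lemma condexp_eq0_ge0 (m : X -> R) : measurable_fun setT m ->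
  (forall t, 0 <= m t) -> is_condexp mu A (fun t => (m t)%:C%C) (cst 0) ->
  \forall t \ae mu, m t = 0.
Proof.
move=> mm m0 mE; have mf := cmeasurable_real mm.
have [e fe] := is_condexp_normc A_sigma A_sub mf mE.
have [F [AF UF Fm _]] := ge0_condexp_exhaustion A_sigma A_sub A_sigma_finite fe.
apply: (ae_bigcup UF) => k.
have [_ _ + _] := is_condexp_parts A_sub mf mE (AF k) (Fm k).
rewrite integral0 => /esym i0.
have mmF : measurable_fun (F k) (EFin \o m) by exact/measurable_EFinP/measurable_funTS.
have /(ae_eq_integral_abs mu (A_sub (AF k)) mmF) :
    (\int[mu]_(t in F k) `|(EFin \o m) t| = 0)%E.
  by rewrite -[RHS]i0; apply: eq_integral => t _; rewrite /= ger0_norm.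
by apply: filterS => t /= mt Ft; have [] := mt Ft.
Qed.

Lemma is_condexp_mulu f : f \in L2fun mu ->
  is_condexp mu A (fun t => u t * f t) (condexp mu A (fun t => u t * f t)).
Proof.
move=> fL; have [_ _ /(_ f fL)[[_ [g ufg]] _]] := uw.
exact: condexp_is_condexp ufg.
Qed.

(** [condexp] picks an unspecified version; uniqueness lets any convenient version compute [T x]. *)
Lemma WCT_repr x g : is_condexp mu A (fun t => u t * repr x t) g ->
  \forall t \ae mu, repr (T x) t = w t * g t.
Proof.
move=> ufg; have xL := repr_L2fun x.
have [_ _ /(_ _ xL)[[mux _] TL]] := uw.
apply: filterS2 (L2_class_repr TL)
  (condexp_ae A_sigma A_sub A_sigma_finite mux ufg) => t.
by rewrite /WCT => -> ->.
Qed.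

(* Take x = rho * conj u / (1 + |u|), so that r = E(u x) is positive on the
   support of u and w r = T x is in L^2: dividing by r then gives access to E of
   products with w, although w itself need not be locally in L^2. *)
Lemma WCT_generator : exists x (r : X -> R[i]), [/\ @cmeasurable _ XA R r,
  \forall t \ae mu, repr (T x) t = w t * r t &
  \forall t \ae mu, r t = 0 -> u t = 0].
Proof.
have [rho [mrho rho0 rho1 rhofin]] := sigma_finite_weight A_sigma A_sub A_sigma_finite.
have mrhoX := measurable_fun_subalgebra A_sigma A_sub mrho.
(* The denominator gives [|f| <= rho] for [f = q conj u], hence [f] in L^2; as [q] is positive,
   [u f = q |u|^2] vanishes only where [u] does. *)
pose q t := rho t * (1 + nc (u t))^-1.
have mq : measurable_fun setT q.
  apply: measurable_funM => //.
  have /cmeasurableV[+ _] : cmeasurable (fun t => (1 + nc (u t))%:C%C).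
    apply: cmeasurable_real; apply: measurable_funD => //.
    exact: cmeasurable_normc.
  by under eq_fun do rewrite -fmorphV.
have q0 t : 0 < q t by rewrite mulr_gt0// invr_gt0 ltr_wpDr// normc_ge0.
pose f t := (q t)%:C%C * (u t)^*.
have mf : cmeasurable f.
  by apply: cmeasurableM; [exact: cmeasurable_real|exact: cmeasurable_conj].
have fL : f \in L2fun mu.
  apply: (L2fun_le mf mrhoX rhofin) => t.
  rewrite Normc.normcM normc_conj.
  have -> : nc (q t)%:C%C = q t.
    by rewrite /= expr0n/= addr0 sqrtr_sqr ger0_norm// ltW.
  rewrite /q -mulrA ler_piMr ?(ltW (rho0 t))// mulrC ler_pdivrMr ?mul1r ?lerDr//.
  by rewrite ltr_wpDr// normc_ge0.
pose m t := q t * nc (u t) ^+ 2.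
have ufE t : u t * f t = (m t)%:C%C.
  by rewrite /f mulrCA mulc_conj -rmorphM.
have muf : cmeasurable (fun t => u t * f t) by exact: cmeasurableM.
have ufr := is_condexp_mulu fL.
set r := condexp _ _ _ in ufr.
have mr : @cmeasurable _ XA R r by have [] := ufr.
exists (L2class mu f), r; split => //.
  apply: WCT_repr; apply: is_condexp_ae ufr => //.
  - by apply: cmeasurableM => //; exact: repr_cmeasurable.
  - by apply: filterS (L2_class_repr fL) => t ->.
(* since 0^-1 = 0, this is the indicator of the zero set of r *)
pose h t := 1 - r t * (r t)^-1.
have mh : @cmeasurable _ XA R h.
  rewrite (_ : h = fun t => 1 + (-1) * (r t * (r t)^-1)); last first.
    by apply/funext => t; rewrite mulN1r.
  apply: cmeasurableD; first exact: cmeasurable_cst.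
  apply: cmeasurableM; first exact: cmeasurable_cst.
  by apply: cmeasurableM => //; exact: cmeasurableV.
have mhX := cmeasurable_subalgebra A_sigma A_sub mh.
have hE t : h t = (r t == 0)%:R.
  by rewrite /h; have [->|r0] := eqVneq (r t) 0; rewrite ?mul0r ?subr0// divff// subrr.
(* [u f] cut to the zero set of [r]: it is nonnegative and has conditional expectation [h r = 0], so
   it vanishes a.e. *)
pose m' t := (r t == 0)%:R * m t.
have hmE t : h t * (u t * f t) = (m' t)%:C%C.
  by rewrite ufE hE /m'; case: eqVneq => _; rewrite ?mul1r ?mul0r.
have : is_condexp mu A (fun t => (m' t)%:C%C) (cst 0).
  have := is_condexp_pull_out A_sigma A_sub A_sigma_finite muf ufr mh.
  rewrite (_ : (fun t => h t * r t) = cst 0); last first.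
    apply/funext => t; rewrite hE; by case: eqVneq => [->|_] /=; rewrite ?mulr0 ?mul0r.
  by rewrite (_ : (fun t => h t * (u t * f t)) = (fun t => (m' t)%:C%C))//;
    apply/funext => t; rewrite hmE.
have mm' : measurable_fun setT m'.
  have [+ _] := cmeasurableM mhX muf.
  by under eq_fun do rewrite hmE.
have m'_ge0 t : 0 <= m' t by rewrite mulr_ge0// mulr_ge0 ?sqr_ge0// ltW.
move=> /(condexp_eq0_ge0 mm' m'_ge0) m'0.
apply: filterS m'0 => t + rt0; rewrite /m' rt0 eqxx mul1r => /eqP.
rewrite mulf_eq0 gt_eqF//= sqrf_eq0 => /eqP.
exact: Normc.eq0_normc.
Qed.

Lemma is_condexp_uw : is_condexp mu A (fun t => u t * w t) phi.
Proof.
(* uw = (u T x) / r a.e., and T x is in L^2 *)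
have [x [r [mr Tx ru]]] := WCT_generator.
have rV := cmeasurable_subalgebra A_sigma A_sub (cmeasurableV mr).
have uTx := is_condexp_mulu (repr_L2fun (T x)).
have muT : cmeasurable (fun t => u t * repr (T x) t).
  by apply: cmeasurableM => //; exact: repr_cmeasurable.
have := is_condexp_pull_out A_sigma A_sub A_sigma_finite muT uTx (cmeasurableV mr).
move=> H; apply: condexp_is_condexp; apply: is_condexp_ae H => //.
- exact: cmeasurableM.
- exact: cmeasurableM.
apply: filterS2 Tx ru => t -> ru.
have [r0|r0] := eqVneq (r t) 0; first by rewrite ru// !mul0r mulr0.
by rewrite mulrC -!mulrA divff// mulr1.
Qed.

Lemma cmeasurable_phi : @cmeasurable _ XA R phi.
Proof. by have [] := is_condexp_uw. Qed.

(** For the [x] of [WCT_generator], [T x = w r] with [u = 0] wherever [r = 0]. Thus [h T x = 0]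
    forces [h u w = 0], whose conditional expectation is [h phi]. *)
Lemma WCT_separates : exists x, forall h, @cmeasurable _ XA R h ->
  (\forall t \ae mu, h t * repr (T x) t = 0) -> \forall t \ae mu, h t * phi t = 0.
Proof.
have [x [r [mr Tx ru]]] := WCT_generator; exists x => h mh hTx.
apply: (is_condexp_pull_out0 _ is_condexp_uw mh); first exact: cmeasurableM.
apply: filterS3 Tx ru hTx => t -> ru.
have [r0 _|r0] := eqVneq (r t) 0; first by rewrite ru// mul0r mulr0.
move=> /eqP; rewrite mulrA mulf_eq0 (negPf r0) orbF mulf_eq0 => /orP[]/eqP->;
  by rewrite ?mul0r// !mulr0.
Qed.

(** With [g = E(u x)], [p = h w g], so [u p] is [u w] times the factor [h g], which can be pulled
    out. *)
Lemma WCT_mul_range x (p : L2 mu) h : @cmeasurable _ XA R h ->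
  (\forall t \ae mu, repr p t = h t * repr (T x) t) ->
  \forall t \ae mu, repr (T p) t = h t * phi t * repr (T x) t.
Proof.
move=> mh ph; have uxg := is_condexp_mulu (repr_L2fun x).
set g := condexp _ _ _ in uxg; have [_ mg _] := uxg.
have Tx := WCT_repr uxg.
have muw : cmeasurable (fun t => u t * w t) by exact: cmeasurableM.
have mhg : @cmeasurable _ XA R (fun t => h t * g t) by exact: cmeasurableM.
have mhgX := cmeasurable_subalgebra A_sigma A_sub mhg.
have H := is_condexp_pull_out A_sigma A_sub A_sigma_finite muw is_condexp_uw mhg.
have {H} /WCT_repr Tp : is_condexp mu A (fun t => u t * repr p t)
    (fun t => h t * g t * phi t).
  apply: is_condexp_ae H => //.
  - exact: cmeasurableM.
  - by apply: cmeasurableM => //; exact: repr_cmeasurable.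
  by apply: filterS2 ph Tx => t -> ->; ring.
by apply: filterS2 Tp Tx => t -> ->; ring.
Qed.
End WCT_operator.

(** * The adjoint of a bounded operator *)

Section WCT_adjoint.
Context d (X : measurableType d) (R : realType) (mu : {measure set X -> \bar R}).
Context (A : set (set X)) (A_sigma : sigma_algebra setT A)
  (A_sub : A `<=` measurable).
Local Notation XA := (g_sigma_algebraType A).
Context (A_sigma_finite : sigma_finite [set: XA] mu).
Context (u w : X -> R[i]) (uw : WCT_weights mu A u w).
Local Notation nc := Normc.normc.
Local Notation T := (WCT mu A u w).
Implicit Types (f g h : X -> R[i]) (x y : L2 mu).

Let measurable_u : cmeasurable u. Proof. by case: uw. Qed.

(* G = E(w r conj y) / r stands for E(w conj y), whose existence is not known;
   the adjoint of T maps y to conj (u G). *)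
Lemma WCT_ip_density y : exists G : X -> R[i], @cmeasurable _ XA R G /\
  forall x (v : X -> R[i]), cmeasurable v -> cintegrable mu setT v ->
    (\forall t \ae mu, v t = u t * repr x t * G t) ->
    L2ip mu (T x) y = cintegral mu setT v.
Proof.
have [x0 [r [mr Tx0 ru]]] := WCT_generator A_sigma A_sub A_sigma_finite uw.
pose K t := repr (T x0) t * (repr y t)^*.
have Ki : cintegrable mu setT K.
  by apply: L2fun_mul_conj; exact: repr_L2fun.
have mK := cintegrable_cmeasurable Ki.
have [k Kk] := is_condexp_exists A_sigma A_sub A_sigma_finite Ki.
have [_ mk _] := Kk; have mrV := cmeasurableV mr.
exists (fun t => (r t)^-1 * k t); split; first exact: cmeasurableM.
move=> x v mv vi vE.
have mux : cmeasurable (fun t => u t * repr x t).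
  by apply: cmeasurableM => //; exact: repr_cmeasurable.
have uxg := is_condexp_mulu uw (repr_L2fun x).
set g := condexp _ _ _ in uxg; have [_ mg _] := uxg.
have Tx := WCT_repr A_sigma A_sub A_sigma_finite uw uxg.
have mG : @cmeasurable _ XA R (fun t => (r t)^-1 * k t) by exact: cmeasurableM.
have mgr : @cmeasurable _ XA R (fun t => g t * (r t)^-1) by exact: cmeasurableM.
have AT := subalgebraT A_sigma.
(* Where [r = 0] also [u x = 0], and the zero set of [r] lies in the subalgebra; this makes
   [g / r * r = g] valid a.e. *)
have gr0 : \forall t \ae mu, r t = 0 -> g t = 0.
  have mh : @cmeasurable _ XA R (fun t => 1 + (-1) * (r t * (r t)^-1)).
    apply: cmeasurableD; first exact: cmeasurable_cst.
    apply: cmeasurableM; first exact: cmeasurable_cst.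
    exact: cmeasurableM.
  have := is_condexp_pull_out0 A_sigma A_sub A_sigma_finite mux uxg mh.
  have hu : \forall t \ae mu, (1 + -1 * (r t / r t)) * (u t * repr x t) = 0.
    apply: filterS ru => t rut; have [r0|r0] := eqVneq (r t) 0.
      by rewrite rut// mul0r mulr0.
    by rewrite divff// mulN1r subrr mul0r.
  move=> /(_ hu); apply: filterS => t + rt0.
  by rewrite rt0 mul0r mulr0 addr0 mul1r.
(* Both sides of the claim equal the integral of [g k / r]: for [v] by pulling [k / r] out of E(u
   x), for [<T x, y>] by pulling [g / r] out of E(K). *)
have vG : cintegral mu setT (fun t => (r t)^-1 * k t * g t) = cintegral mu setT v.
  have H := is_condexp_pull_out A_sigma A_sub A_sigma_finite mux uxg mG.
  have {H}[_ _ H] : is_condexp mu A v (fun t => (r t)^-1 * k t * g t).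
    apply: (is_condexp_ae A_sigma A_sub _ mv _ H).
      apply: cmeasurableM => //; exact: (cmeasurable_subalgebra A_sigma A_sub mG).
    by apply: filterS vE => t ->; rewrite mulrC.
  by have [] := H _ AT vi.
have Ti : cintegrable mu setT (fun t => repr (T x) t * (repr y t)^*).
  by apply: L2fun_mul_conj; exact: repr_L2fun.
have TG : cintegral mu setT (fun t => g t * (r t)^-1 * k t) = L2ip mu (T x) y.
  have H := is_condexp_pull_out A_sigma A_sub A_sigma_finite mK Kk mgr.
  have {H}[_ _ H] : is_condexp mu A (fun t => repr (T x) t * (repr y t)^*)
      (fun t => g t * (r t)^-1 * k t).
    apply: (is_condexp_ae A_sigma A_sub _ _ _ H).
    - apply: cmeasurableM => //; exact: (cmeasurable_subalgebra A_sigma A_sub mgr).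
    - exact: cintegrable_cmeasurable Ti.
    apply: filterS3 Tx0 Tx gr0 => t; rewrite /K => -> -> gt0.
    have [r0|r0] := eqVneq (r t) 0; first by rewrite gt0// !(mul0r, mulr0).
    by rewrite mulrA [w t * r t]mulrC mulrA mulfVK// [g t * w t]mulrC.
  by have [] := H _ AT Ti.
rewrite -vG -TG; apply: eq_cintegral => t.
by rewrite [RHS]mulrC mulrA.
Qed.

(** Monotone convergence carries the uniform bound on the truncations over to [f]. *)
Lemma L2fun_monotone (f : X -> R[i]) (F : nat -> set X) (c : R) : cmeasurable f ->
  (forall n, measurable (F n)) -> nondecreasing_seq F -> \bigcup_n F n = setT ->
  (forall n, (\int[mu]_t (nc ((\1_(F n) t)%:C%C * f t) ^+ 2)%:E <= c%:E)%E) ->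
  f \in L2fun mu.
Proof.
move=> mf mF ndF UF Fc; apply/L2funE; split => //.
apply: (@le_lt_trans _ _ c%:E); last exact: ltry.
pose k n t := (nc ((\1_(F n) t)%:C%C * f t) ^+ 2)%:E.
have kE n t : k n t = (\1_(F n) t * nc (f t) ^+ 2)%:E.
  rewrite /k Normc.normcM exprMn; congr (_ * _)%:E.
  by rewrite indicE; case: (_ \in _); rewrite ?Normc.normc1 ?Normc.normc0 ?expr1n ?expr0n.
have ndk t : nondecreasing_seq (k ^~ t).
  move=> a b ab; rewrite !kE lee_fin ler_wpM2r ?sqr_ge0// !indicE ler_nat.
  have [ta|//] := boolP (t \in F a); rewrite inE in ta.
  have /subsetPset ab' := ndF _ _ ab.
  by rewrite mem_set//; exact: ab'.
have klim t : (nc (f t) ^+ 2)%:E = limn (k ^~ t).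
  have : [set: X] t by []; rewrite -UF => -[N _ FNt].
  apply/esym; apply: lim_near_cst => //.
  exists N => // n /= Nn; rewrite kE indicE mem_set ?mul1r//.
  by have /subsetPset := ndF _ _ Nn; exact.
under eq_integral do rewrite klim.
have mk n : measurable_fun setT (k n).
  apply/measurable_EFinP; apply: measurable_funX; apply: cmeasurable_normc.
  by apply: cmeasurableM => //; exact: cmeasurable_real.
have k0 n t : (0 <= k n t)%E by rewrite lee_fin sqr_ge0.
rewrite monotone_convergence//; apply: lime_le; last exact: nearW.
apply: ereal_nondecreasing_is_cvgn => a b ab.
by apply: ge0_le_integral => // t _; exact: ndk.
Qed.

(** Once [s = conj (u G)] is known to be in L^2, the density formula concludes. Each truncation [x]
    of [s] satisfies [<T x, y> = <x, x>], and the bound on [T] controls |x| independently of the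
    truncation. *)
Lemma WCT_ip_representable y : bounded_op (L2ip mu) T ->
  exists s : L2 mu, forall x, L2ip mu (T x) y = L2ip mu x s.
Proof.
move=> [_ [M TM]].
(* Used with [a], [b], [c] the squared norms of [T x], [x], [y]. The coefficient [M^2 + 1] leaves
   [(M^2 + 2) b] on the left after [a] is absorbed. *)
have absorb (a b c : R) : a <= M ^+ 2 * b ->
    2 * (M ^+ 2 + 1) * b <= a + (M ^+ 2 + 1) ^+ 2 * c -> 0 <= b ->
    b <= (M ^+ 2 + 1) ^+ 2 * c.
  have := sqr_ge0 M; move: (M ^+ 2) => N; nra.
have [G [mG yG]] := WCT_ip_density y.
have mGX := cmeasurable_subalgebra A_sigma A_sub mG.
have [rho [mrho rho0 rho1 rhofin]] := sigma_finite_weight A_sigma A_sub A_sigma_finite.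
have mrhoX := measurable_fun_subalgebra A_sigma A_sub mrho.
pose s t := (u t * G t)^*.
have ms : cmeasurable s by apply: cmeasurable_conj; exact: cmeasurableM.
(* On [F n] the function [s] is dominated by [n rho], which is square integrable; positivity of
   [rho] makes these sets exhaust the space. *)
pose F n := [set t | nc (s t) <= n%:R * rho t].
have mF n : measurable (F n).
  rewrite -[F n]setTI; apply: measurable_fun_ler => //.
    exact: cmeasurable_normc.
  exact: measurable_funM.
have sL : s \in L2fun mu.
  apply: (@L2fun_monotone _ F ((M ^+ 2 + 1) ^+ 2 * hnorm (L2ip mu) y ^+ 2)) => //.
  - move=> a b ab; apply/subsetPset => t; rewrite /F /= => /le_trans; apply.
    by rewrite ler_pM2r// ler_nat.
  - apply/seteqP; split => // t _.
    exists (Num.truncn (nc (s t) / rho t)).+1 => //=.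
    by rewrite /F /= -ler_pdivrMr//; apply/ltW; exact: truncnS_gt.
  move=> n; pose f t := (\1_(F n) t)%:C%C * s t.
  have mf : cmeasurable f by apply: cmeasurableM => //; exact: cmeasurable_real.
  have fL : f \in L2fun mu.
    apply: (@L2fun_le _ _ _ mu (fun t => n%:R * rho t)) => //.
    - exact: measurable_funM.
    - under eq_integral do rewrite exprMn EFinM.
      rewrite ge0_integralZl//.
      + by rewrite lte_mul_pinfty// lee_fin sqr_ge0.
      + by apply/measurable_EFinP; exact: measurable_funX.
      + by move=> t _; rewrite lee_fin sqr_ge0.
    - move=> t; rewrite /f indicE; have [|_] := boolP (t \in F n).
        by rewrite inE /F /= mul1r.
      by rewrite mul0r Normc.normc0 mulr_ge0// ltW.
  pose x := L2class mu f.
  have xf : \forall t \ae mu, repr x t = f t by exact: L2_class_repr.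
  rewrite -/f (_ : (\int[mu]_t _)%E = (hnorm (L2ip mu) x ^+ 2)%:E); last first.
    rewrite -integral_sqr_normc; apply: ae_eq_integral => //.
    - apply/measurable_EFinP; apply: measurable_funX.
      exact: cmeasurable_normc.
    - exact: measurable_sqr_normc.
    - by apply: filterS xf => t ->.
  (* x is a truncation of s, so <T x, y> = |x|^2, which bounds |x| uniformly *)
  have xi : cintegrable mu setT (fun t => repr x t * (repr x t)^*).
    by apply: L2fun_mul_conj; exact: repr_L2fun.
  have Txy : L2ip mu (T x) y = L2ip mu x x.
    apply: (yG x _ _ xi); first exact: cintegrable_cmeasurable xi.
    apply: filterS xf => t ->; rewrite /f indicE.
    case: (t \in F n); last by rewrite !mul0r mulr0 mul0r.
    by rewrite !mul1r /s conjCK [RHS]mulrAC mulrC.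
  have TxM : hnorm (L2ip mu) (T x) ^+ 2 <= M ^+ 2 * hnorm (L2ip mu) x ^+ 2.
    rewrite -exprMn ler_pXn2r ?nnegrE ?hnorm_ge0//.
    exact: le_trans (hnorm_ge0 _) (TM x).
  have := L2ip_le (T x) y (M ^+ 2 + 1).
  rewrite Txy L2ip_hnorm /= lee_fin => xy.
  exact: absorb TxM xy (sqr_ge0 _).
exists (L2class mu s) => x.
have si := L2fun_mul_conj (repr_L2fun x) (repr_L2fun (L2class mu s)).
apply: (yG x _ _ si); first exact: cintegrable_cmeasurable si.
apply: filterS (L2_class_repr sL) => t ->.
by rewrite /s conjCK mulrCA mulrA.
Qed.

(** The representers of all [y], assembled by choice, form an operator satisfying the adjoint
    identity, so [adjoint] does not fall back on its default. *)
Lemma WCT_adjointE x y : bounded_op (L2ip mu) T ->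
  L2ip mu (T x) y = L2ip mu x (adjoint (L2ip mu) T y).
Proof.
move=> Tb; have /choice[S TS] := fun z => WCT_ip_representable z Tb.
rewrite /adjoint; case: xgetP => [? _ ->//|/(_ S) []].
by move=> a b; exact: TS.
Qed.
End WCT_adjoint.

(** * Powers, spectrum and quasi-contractivity *)

Section quasi_contraction_norm.
Context d (X : measurableType d) (R : realType) (mu : {measure set X -> \bar R}).
Context (T : L2 mu -> L2 mu).
Context (TE : forall x y, L2ip mu (T x) y = L2ip mu x (adjoint (L2ip mu) T y)).

Lemma L2ip_iter_adjoint n x y :
  L2ip mu (iter n (adjoint (L2ip mu) T) y) x = L2ip mu y (iter n T x).
Proof.
elim: n x => //= n IH x.
by rewrite L2ip_conj -TE L2ip_conj conjCK IH -iterSr.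
Qed.

Lemma quasi_contractionP n : quasi_contraction (L2ip mu) n T <->
  forall x, hnorm (L2ip mu) (iter n.+1 T x) <= hnorm (L2ip mu) (iter n T x).
Proof.
have E x : L2ip mu (iter n (adjoint (L2ip mu) T) (iter n T x) -
      iter n.+1 (adjoint (L2ip mu) T) (iter n.+1 T x)) x =
    (hnorm (L2ip mu) (iter n T x) ^+ 2 - hnorm (L2ip mu) (iter n.+1 T x) ^+ 2)%:C%C.
  have BL a b z : L2ip mu (a - b) z = L2ip mu a z - L2ip mu b z by exact: linearBl.
  by rewrite BL !L2ip_iter_adjoint !L2ip_hnorm rmorphB.
split=> [qc x|nT x].
  have := qc x; rewrite [X in 0 <= X]E -(rmorph0 (real_complex R)) lecR subr_ge0.
  by rewrite ler_pXn2r ?nnegrE ?hnorm_ge0.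
rewrite [X in 0 <= X]E -(rmorph0 (real_complex R)) lecR subr_ge0.
by rewrite ler_pXn2r ?nnegrE ?hnorm_ge0.
Qed.

Lemma quasi_contraction1 n : quasi_contraction (L2ip mu) 1 T -> (0 < n)%N ->
  quasi_contraction (L2ip mu) n T.
Proof.
move=> /quasi_contractionP T1; case: n => // n _; apply/quasi_contractionP.
elim: n => [|n IH] x; first exact: T1.
by rewrite iterSr [iter n.+2 T x]iterSr; exact: IH.
Qed.
End quasi_contraction_norm.

(** * Powers of the operator and the size of E(uw) *)

Section WCT_powers.
Context d (X : measurableType d) (R : realType) (mu : {measure set X -> \bar R}).
Context (A : set (set X)) (A_sigma : sigma_algebra setT A)
  (A_sub : A `<=` measurable).
Local Notation XA := (g_sigma_algebraType A).
Context (A_sigma_finite : sigma_finite [set: XA] mu).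
Context (u w : X -> R[i]) (uw : WCT_weights mu A u w).
Local Notation nc := Normc.normc.
Local Notation T := (WCT mu A u w).
Local Notation N := (hnorm (L2ip mu)).
Local Notation phi := (condexp mu A (fun t => u t * w t)).
Implicit Types (h : X -> R[i]) (x : L2 mu).

Let mphi : @cmeasurable _ XA R phi.
Proof. exact: cmeasurable_phi uw. Qed.

Lemma iter_WCT x (p : L2 mu) h k : @cmeasurable _ XA R h ->
  (\forall t \ae mu, repr p t = h t * repr (T x) t) ->
  \forall t \ae mu, repr (iter k T p) t = h t * phi t ^+ k * repr (T x) t.
Proof.
move=> mh ph; elim: k => [|k IH]; first by apply: filterS ph => t ->; rewrite expr0 mulr1.
have mhk : @cmeasurable _ XA R (fun t => h t * phi t ^+ k).
  by apply: cmeasurableM => //; exact: cmeasurableX.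
have := WCT_mul_range A_sigma A_sub A_sigma_finite uw mhk IH.
by apply: filterS => t; rewrite iterS => ->; rewrite exprSr mulrA.
Qed.

Lemma iterS_WCT x k :
  \forall t \ae mu, repr (iter k.+1 T x) t = phi t ^+ k * repr (T x) t.
Proof.
rewrite iterSr; have := @iter_WCT x (T x) (cst 1) k (cmeasurable_cst _ _).
have H : \forall t \ae mu, repr (T x) t = cst 1 t * repr (T x) t.
  by apply: aeW => t; rewrite mul1r.
by move=> /(_ H); apply: filterS => t ->; rewrite mul1r.
Qed.

(** Only powers from the first on are compared, since multiplication by [phi] describes [T] on its
    range. With [k = 0] this bounds all positive powers by [T], and [l = 1] is then the
    1-quasi-contraction inequality. *)
Lemma hnorm_iter_WCT_contract x k l : (\forall t \ae mu, nc (phi t) <= 1) ->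
  N (iter (l + k).+1 T x) <= N (iter k.+1 T x).
Proof.
move=> phi1; rewrite -[leRHS]mul1r; apply: hnorm_le => //.
apply: filterS3 (iterS_WCT x (l + k)) (iterS_WCT x k) phi1 => t -> -> p1.
rewrite mul1r exprD -mulrA Normc.normcM ler_piMl ?normc_ge0//.
elim: l => [|l IH]; first by rewrite Normc.normc1.
by rewrite exprS Normc.normcM mulr_ile1 ?normc_ge0.
Qed.

Definition cindic (S : set X) (t : X) : R[i] := (\1_S t)%:C%C.

Lemma cindicE (S : set X) t : cindic S t = (t \in S)%:R.
Proof. by rewrite /cindic indicE; case: (_ \in _). Qed.

Lemma normc_cindic (S : set X) t : nc (cindic S t) <= 1.
Proof.
by rewrite cindicE; case: (_ \in _); rewrite ?Normc.normc1 ?Normc.normc0.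
Qed.

Lemma cmeasurable_cindic (S : set X) : A S -> @cmeasurable _ XA R (cindic S).
Proof.
move=> AS; apply: cmeasurable_real; apply: measurable_indic.
exact: measurable_subalgebra.
Qed.

Lemma WCT_cut (S : set X) x : A S -> exists p : L2 mu,
  \forall t \ae mu, repr p t = cindic S t * repr (T x) t.
Proof.
move=> AS; exists (L2mul (cindic S) (T x)); apply: (@L2_mul_repr _ _ _ _ _ 1).
  exact: (cmeasurable_subalgebra A_sigma A_sub (cmeasurable_cindic AS)).
exact: normc_cindic.
Qed.

(** The vanishing cut is applied to the single vector supplied by [WCT_separates]. *)
Lemma phi_avoids (S : set X) : A S ->
  (forall x (p : L2 mu), (\forall t \ae mu, repr p t = cindic S t * repr (T x) t) ->
    p = 0) ->
  \forall t \ae mu, S t -> phi t = 0.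
Proof.
move=> AS S0; have [x xphi] := WCT_separates A_sigma A_sub A_sigma_finite uw.
have [p px] := WCT_cut x AS; have p0 := S0 x p px.
have : \forall t \ae mu, cindic S t * phi t = 0.
  apply: xphi; first exact: cmeasurable_cindic.
  by rewrite p0 in px; apply: filterS2 px (@L2_repr0 _ X R mu) => t <-.
by apply: filterS => t + St; rewrite cindicE mem_set// mul1r.
Qed.

(** The set where |phi| > 1 is the union over [n] of those where |phi| >= 1 + 1/(n+1); on each of
    them [phi] would be 0 a.e., so it is null. The gap between [c] and 1 supplies a uniform growth
    factor. *)
Lemma phi_le1 : (forall (c : R) x (p : L2 mu), 1 < c ->
    (\forall t \ae mu,
      repr p t = cindic [set t | c <= nc (phi t)] t * repr (T x) t) -> p = 0) ->
  \forall t \ae mu, nc (phi t) <= 1.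
Proof.
move=> H.
have AS (c : R) : A [set t | c <= nc (phi t)].
  by apply: subalgebra_le => //; exact: cmeasurable_normc mphi.
have /ae_foralln : forall n, \forall t \ae mu,
    1 + n.+1%:R^-1 <= nc (phi t) -> phi t = 0.
  move=> n; apply: (phi_avoids (AS _)) => x p; apply: H.
  by rewrite ltrDl invr_gt0.
apply: filterS => t phi0; rewrite leNgt; apply/negP => phi1.
have := phi1; rewrite -subr_gt0 => /ltr_add_invr[n].
rewrite add0r => /ltW; rewrite lerBrDl => /phi0 E.
by move: phi1; rewrite E Normc.normc0 ltr10.
Qed.

(** [h] is left general to cover [1_S], its product with a power of [phi], and its scalar
    multiples. *)
Lemma hnorm_cut_iter (c : R) x (p : L2 mu) h k : 0 < c ->
  @cmeasurable _ XA R h ->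
  (forall t, h t != 0 -> c <= nc (phi t)) ->
  (\forall t \ae mu, repr p t = h t * repr (T x) t) ->
  c ^+ k * N p <= N (iter k T p).
Proof.
move=> c0 mh hc px; rewrite mulrC -ler_pdivlMr ?exprn_gt0// mulrC.
apply: hnorm_le; first by rewrite invr_ge0 exprn_ge0// ltW.
apply: filterS2 px (iter_WCT k mh px) => t -> ->.
have [->|h0] := eqVneq (h t) 0; first by rewrite !mul0r Normc.normc0 mulr0.
rewrite [leRHS]mulrC ler_pdivlMr ?exprn_gt0// [in leRHS]mulrAC [leRHS]Normc.normcM.
rewrite ler_wpM2l ?normc_ge0//.
elim: k => [|k IH]; first by rewrite !expr0 Normc.normc1.
by rewrite !exprS Normc.normcM ler_pM ?hc// ?exprn_ge0// ltW.
Qed.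

Lemma cindic_neq0 (S : set X) t : cindic S t != 0 -> S t.
Proof. by rewrite cindicE; case: (boolP (t \in S)) => [/set_mem//|]; rewrite eqxx. Qed.

(** For [p = 1_S T x], c |T^n p| <= |T^(n+1) p| <= |T^n p| forces [T^n p = 0], and then c^n |p| <=
    |T^n p| forces [p = 0]. *)
Lemma quasi_contraction_phi n :
  (forall x, N (iter n.+1 T x) <= N (iter n T x)) ->
  \forall t \ae mu, nc (phi t) <= 1.
Proof.
move=> nT; apply: phi_le1 => c x p c1 px.
have c0 : 0 < c := lt_trans ltr01 c1.
pose S := [set t | c <= nc (phi t)].
have mS : @cmeasurable _ XA R (cindic S).
  by apply: cmeasurable_cindic; apply: subalgebra_le => //; exact: cmeasurable_normc mphi.
have hS t : cindic S t != 0 -> c <= nc (phi t) by move/cindic_neq0.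
have Tpx : \forall t \ae mu,
    repr (iter n T p) t = (cindic S t * phi t ^+ n) * repr (T x) t.
  exact: (iter_WCT n mS px).
have mSn : @cmeasurable _ XA R (fun t => cindic S t * phi t ^+ n).
  by apply: cmeasurableM => //; exact: cmeasurableX.
have := @hnorm_cut_iter c x (iter n T p) _ 1 c0 mSn _ Tpx.
have hSn t : cindic S t * phi t ^+ n != 0 -> c <= nc (phi t).
  by rewrite mulf_eq0 negb_or => /andP[/hS].
move=> /(_ hSn) /=; rewrite expr1 => /le_trans /(_ (nT p)).
rewrite -subr_le0 -[X in _ - X]mul1r -mulrBl pmulr_rle0 ?subr_gt0// => /hnorm_le0 Tp0.
apply: hnorm_le0; have := hnorm_cut_iter n c0 mS hS px.
by rewrite Tp0 hnorm0 pmulr_rle0 ?exprn_gt0.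
Qed.
End WCT_powers.

(** * Power boundedness and spectrum *)

Section WCT_power_bounded.
Context d (X : measurableType d) (R : realType) (mu : {measure set X -> \bar R}).
Context (A : set (set X)) (A_sigma : sigma_algebra setT A)
  (A_sub : A `<=` measurable).
Local Notation XA := (g_sigma_algebraType A).
Context (A_sigma_finite : sigma_finite [set: XA] mu).
Context (u w : X -> R[i]) (uw : WCT_weights mu A u w).
Local Notation nc := Normc.normc.
Local Notation T := (WCT mu A u w).
Local Notation N := (hnorm (L2ip mu)).
Local Notation phi := (condexp mu A (fun t => u t * w t)).
Context (Tb : bounded_op (L2ip mu) T).

Let mphi : @cmeasurable _ XA R phi.
Proof. exact: cmeasurable_phi uw. Qed.

Lemma phi_power_bounded : (\forall t \ae mu, nc (phi t) <= 1) ->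
  power_bounded (L2ip mu) T.
Proof.
move=> phi1; have [_ [M TM]] := Tb.
(* The sign of [M] is not known, hence the absolute value. *)
apply: (@le_lt_trans _ _ `|M|%:E); last exact: ltry.
apply: ge_ereal_sup => _ [n n0 <-]; apply: ge_ereal_sup => _ [x /= x1 <-].
rewrite lee_fin; case: n n0 => // n _.
have := hnorm_iter_WCT_contract A_sigma A_sub A_sigma_finite uw x 0 n phi1.
rewrite addn0 => /le_trans; apply; apply: le_trans (TM x) _.
apply: le_trans (ler_norm _) _; rewrite normrM ler_piMr//.
by rewrite ger0_norm ?hnorm_ge0.
Qed.

(** Bernoulli's inequality reduces this to the Archimedean property. *)
Lemma expr_unbounded (c K : R) : 1 < c -> exists k, K < c ^+ k.
Proof.
move=> c1; have B k : 1 + k%:R * (c - 1) <= c ^+ k.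
  elim: k => [|k IH]; first by rewrite mul0r addr0 expr0.
  have c0 : 0 <= c by rewrite ltW// (lt_trans ltr01).
  rewrite exprSr; apply: le_trans (ler_wpM2r c0 IH).
  have := mulr_ge0 (ler0n R k) (sqr_ge0 (c - 1)).
  rewrite -natr1 -subr_ge0; congr (0 <= _); ring.
have c10 : 0 < c - 1 by rewrite subr_gt0.
exists (Num.truncn (K / (c - 1))).+1; apply: lt_le_trans (B _).
have := truncnS_gt (K / (c - 1)); rewrite ltr_pdivrMr//.
move=> /lt_trans; apply; by rewrite ltrDr.
Qed.

Lemma power_bounded_phi : power_bounded (L2ip mu) T ->
  \forall t \ae mu, nc (phi t) <= 1.
Proof.
rewrite /power_bounded; set b := ereal_sup _ => b_lty.
have Tn n y : (0 < n)%N -> N y <= 1 -> ((N (iter n T y))%:E <= b)%E.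
  move=> n0 y1; apply: (@le_trans _ _ (opnorm (L2ip mu) (iter n T))).
    by apply: ereal_sup_ubound; exists y.
  by apply: ereal_sup_ubound; exists n.
have bfin : b \is a fin_num.
  rewrite fin_numElt b_lty andbT.
  apply: lt_le_trans (Tn 1%N 0 isT _); last by rewrite hnorm0.
  by rewrite ltNyr.
apply: (phi_le1 A_sigma A_sub A_sigma_finite uw) => c x p c1 px.
have c0 : 0 < c := lt_trans ltr01 c1.
apply: hnorm_le0; rewrite leNgt; apply/negP => Np.
pose S := [set t | c <= nc (phi t)].
(* [opnorm] is a supremum over the unit ball, so [p] is normalised. *)
pose a : R[i] := (N p)^-1%:C%C.
have na : nc a = (N p)^-1.
  by rewrite /= expr0n/= addr0 sqrtr_sqr ger0_norm// invr_ge0 ltW.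
have y1 : N (a *: p) = 1 by rewrite hnormZ na mulVf// gt_eqF.
have mS : @cmeasurable _ XA R (cindic R S).
  apply: (cmeasurable_cindic R A_sigma).
  by apply: subalgebra_le => //; exact: cmeasurable_normc mphi.
have mh : @cmeasurable _ XA R (fun t => a * cindic R S t).
  by apply: cmeasurableM => //; exact: cmeasurable_cst.
have hS t : a * cindic R S t != 0 -> c <= nc (phi t).
  by rewrite mulf_eq0 negb_or => /andP[_ /cindic_neq0].
have yE : \forall t \ae mu, repr (a *: p) t = a * cindic R S t * repr (T x) t.
  by apply: filterS2 px (L2_reprZ a p) => t px -> ; rewrite px mulrA.
have [k ck] := expr_unbounded (fine b) c1.
(* The exponent is [k.+1] because [b] ranges over positive powers only. *)
have := hnorm_cut_iter A_sigma A_sub A_sigma_finite uw k.+1 c0 mh hS yE.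
rewrite y1 mulr1 => ckT.
have := Tn k.+1 (a *: p) isT; rewrite y1 lexx => /(_ isT).
rewrite -(fineK bfin) lee_fin leNgt => /negP; apply.
apply: lt_le_trans ckT; apply: lt_le_trans ck _.
by rewrite exprS ler_peMl ?exprn_ge0// ltW.
Qed.

Lemma phi_spectrum : (\forall t \ae mu, nc (phi t) <= 1) ->
  spectrum (L2ip mu) T `<=` [set z | `|z| <= 1].
Proof.
move=> phi1 z Tz /=; rewrite normcE lecR leNgt; apply/negP => z1; apply: Tz.
have z0 : z != 0.
  by apply/eqP => zE; move: z1; rewrite zE Normc.normc0 ltr10.
have [Tlin [M TM]] := Tb.
have AS : A [set t | nc (phi t) <= 1].
  by apply: subalgebra_le => //; exact: cmeasurable_normc mphi.
(* the cut-off makes [h] bounded everywhere, not just a.e. *)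
pose h t := cindic R [set t | nc (phi t) <= 1] t * (z - phi t)^-1.
have mh : @cmeasurable _ XA R h.
  apply: cmeasurableM; first exact: cmeasurable_cindic.
  apply: cmeasurableV; apply: cmeasurableD; first exact: cmeasurable_cst.
  rewrite (_ : (fun t => - phi t) = (fun t => (-1) * phi t)); last first.
    by apply/funext => t; rewrite mulN1r.
  by apply: cmeasurableM => //; exact: cmeasurable_cst.
have mhX := cmeasurable_subalgebra A_sigma A_sub mh.
have zphi t : nc (phi t) <= 1 -> nc z - 1 <= nc (z - phi t).
  move=> p1; have := le_normcD (z - phi t) (phi t).
  by rewrite subrK lerBlDr => /le_trans; apply; rewrite lerD2l.
have hc t : nc (h t) <= (nc z - 1)^-1.
  rewrite /h cindicE; case: (boolP (t \in _)) => [|_]; last first.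
    by rewrite mul0r Normc.normc0 invr_ge0 subr_ge0 ltW.
  rewrite inE /= => p1; rewrite mul1r Normc.normcV lef_pV2 ?zphi// posrE ?subr_gt0//.
  by apply: lt_le_trans (zphi _ p1); rewrite subr_gt0.
have hphi : \forall t \ae mu, h t * (z - phi t) = 1.
  apply: filterS phi1 => t p1; rewrite /h cindicE mem_set// mul1r mulVf//.
  apply/eqP => zE; have := zphi t p1.
  by rewrite zE Normc.normc0 subr_le0 leNgt z1.
have hx (y : L2 mu) := L2_mul_repr y mhX hc.
(* from T (h T x) = h phi T x one gets (T - z)^-1 = - z^-1 (1 + (z - phi)^-1 T) *)
pose L x := L2mul h (T x).
exists (fun x => - z^-1 *: (x + L x)); split.
- split.
    move=> k x y; have Llin : L (k *: x + y) = k *: L x + L y.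
      by rewrite /L Tlin (L2mul_linear mhX hc).
    rewrite Llin [in RHS]scalerA [k * _]mulrC -scalerA -scalerDr; congr (_ *: _).
    by rewrite scalerDr addrACA.
  have c0 : 0 <= (nc z - 1)^-1 by rewrite invr_ge0 subr_ge0 ltW.
  exists (nc (- z^-1) * (2 * (1 + (nc z - 1)^-1 * M))) => x.
  rewrite hnormZ -mulrA ler_wpM2l ?normc_ge0//.
  apply: le_trans (hnormD _ _) _; rewrite -mulrA ler_wpM2l//.
  rewrite mulrDl mul1r lerD2l -mulrA; apply: le_trans (hnorm_L2mul _ mhX c0 hc) _.
  by rewrite ler_wpM2l.
(* Since [T (T x - z x) = (phi - z) T x], the factor [h] cancels up to sign. *)
- move=> x; have TxE : L (T x - z *: x) = - T x.
    apply: L2_aeP.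
    have Tp : \forall t \ae mu,
        repr (T (T x - z *: x)) t = (phi t - z) * repr (T x) t.
      have -> : T (T x - z *: x) = (- z) *: T x + T (T x).
        by rewrite addrC -scaleNr Tlin.
      apply: filterS3 (L2_reprD (- z *: T x) (T (T x))) (L2_reprZ (- z) (T x))
        (iterS_WCT A_sigma A_sub A_sigma_finite uw x 1) => t -> -> /= ->.
      by rewrite expr1 -mulrDl addrC.
    have TH : \forall t \ae mu, repr (T (T x - z *: x)) t = (phi t - z) * repr (T x) t /\
        h t * (z - phi t) = 1 by apply: filterS2 Tp hphi => t; split.
    apply: filterS3 TH (hx (T (T x - z *: x))) (L2_reprZ (-1) (T x)).
    move=> t [Tpt hpt] -> ; rewrite scaleN1r => ->.
    by rewrite Tpt mulrA -opprB mulrN hpt.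
  rewrite TxE addrAC subrr add0r scalerN scaleNr opprK scalerA.
  by rewrite mulVf// scale1r.
- move=> x.
  pose q := L x.
  have Tq : \forall t \ae mu, repr (T q) t = h t * phi t * repr (T x) t.
    exact: (WCT_mul_range A_sigma A_sub A_sigma_finite uw mh (hx (T x))).
  have Tqz : T q - z *: q = - T x.
    apply: L2_aeP.
    have E : \forall t \ae mu, repr (T q - z *: q) t =
        h t * phi t * repr (T x) t - z * repr q t.
      rewrite -scaleNr.
      apply: filterS3 (L2_reprD (T q) (- z *: q)) (L2_reprZ (- z) q) Tq.
      by move=> t -> -> ->; rewrite mulNr.
    have EH : \forall t \ae mu, repr (T q - z *: q) t =
        h t * phi t * repr (T x) t - z * repr q t /\ h t * (z - phi t) = 1.
      by apply: filterS2 E hphi => t; split.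
    apply: filterS3 EH (hx (T x)) (L2_reprZ (-1) (T x)).
    move=> t [-> hpt] qt; rewrite scaleN1r => ->; rewrite /q /L qt mulN1r.
    rewrite -[in RHS](mul1r (repr (T x) t)) -hpt.
    by rewrite mulrBr mulrBl opprB mulrA [z * h t]mulrC.
  have TZ k v : T (k *: v) = k *: T v.
    have T0 : T 0 = 0.
      have := Tlin 1 0 0; rewrite !scale1r addr0 => /eqP.
      by rewrite -subr_eq0 opprD addNKr oppr_eq0 => /eqP.
    by rewrite -[k *: v]addr0 Tlin T0 addr0.
  have TD v v' : T (v + v') = T v + T v'.
    by rewrite -[v]scale1r Tlin !scale1r.
  rewrite TZ TD -/q scalerA [z * _]mulrC -scalerA -scalerBr [z *: (_ + _)]scalerDr.
  rewrite opprD addrACA Tqz.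
  rewrite addrAC subrr add0r scalerN scaleNr opprK scalerA.
  by rewrite mulVf// scale1r.
Qed.

Lemma spectrum_phi_ball (z : R[i]) : ~ spectrum (L2ip mu) T z -> 1 < nc z ->
  exists2 e : R, 0 < e & \forall t \ae mu, e <= nc (phi t - z).
Proof.
move=> /contrapT[S [[_ [K SK]] ST _]] z1.
(* The second bound gives [|K| e < 1], against the bound [K] on the inverse. The first excludes the
   remaining value [phi = 0], whose distance to [z] is |z|. *)
pose e := Num.min (nc z) (2 * (`|K| + 1))^-1.
have K1 : 0 < 2 * (`|K| + 1) by rewrite mulr_gt0// ltr_wpDl.
have e0 : 0 < e by rewrite lt_min (lt_trans ltr01 z1) invr_gt0.
exists e => //; pose B := [set t | nc (phi t - z) < e].
have mphiz : @cmeasurable _ XA R (fun t => phi t - z).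
  by apply: cmeasurableD => //; exact: cmeasurable_cst.
have AB : A B by apply: subalgebra_lt => //; exact: cmeasurable_normc mphiz.
have := phi_avoids A_sigma A_sub A_sigma_finite uw AB.
have B0 x (p : L2 mu) :
    (\forall t \ae mu, repr p t = cindic R B t * repr (T x) t) -> p = 0.
  move=> px; have mB := cmeasurable_cindic R A_sigma AB.
  have Tp := WCT_mul_range A_sigma A_sub A_sigma_finite uw mB px.
  have Tpz : \forall t \ae mu, repr (T p - z *: p) t = (phi t - z) * repr p t.
    rewrite -scaleNr.
    have pT : \forall t \ae mu, repr p t = cindic R B t * repr (T x) t /\
        repr (T p) t = cindic R B t * phi t * repr (T x) t.
      by apply: filterS2 px Tp => t; split.
    apply: filterS3 pT (L2_reprD (T p) (- z *: p)) (L2_reprZ (- z) p).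
    by move=> t [pt Tpt] -> ->; rewrite Tpt pt; ring.
  have le1 : N (T p - z *: p) <= e * N p.
    apply: hnorm_le; first exact: ltW.
    apply: filterS2 Tpz px => t -> ->; rewrite Normc.normcM cindicE.
    case: (boolP (t \in B)) => [|_]; last by rewrite mul0r Normc.normc0 !mulr0 lexx.
    rewrite inE /B /= => /ltW tB; rewrite ler_wpM2r ?normc_ge0//.
  apply: hnorm_le0; rewrite leNgt; apply/negP => p0.
  have := SK (T p - z *: p); rewrite ST leNgt => /negP; apply.
  apply: (@le_lt_trans _ _ (`|K| * (e * N p))).
    apply: (@le_trans _ _ (`|K| * N (T p - z *: p))); last exact: ler_wpM2l.
    by rewrite ler_wpM2r ?hnorm_ge0// ler_norm.
  rewrite mulrA gtr_pMl//.
  apply: (@le_lt_trans _ _ (`|K| * (2 * (`|K| + 1))^-1)).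
    by rewrite ler_wpM2l// ge_min lexx orbT.
  by rewrite ltr_pdivrMr// mul1r; have := normr_ge0 K; lra.
move=> /(_ B0); apply: filterS => t Bt; rewrite leNgt; apply/negP => tB.
have := tB; rewrite (Bt tB) sub0r normcN lt_min => /andP[].
by rewrite ltxx.
Qed.

(** [spectrum_phi_ball] has a null exceptional set for each [z], but here [z = phi t] varies with
    [t]; discs with rational centre and radius 1/(n+1) leave only countably many null sets. *)
Lemma spectrum_phi : spectrum (L2ip mu) T `<=` [set z | `|z| <= 1] ->
  \forall t \ae mu, nc (phi t) <= 1.
Proof.
move=> sT.
pose P (c : rat * rat * nat) t := c.2.+1%:R^-1 <=
  nc (phi t - Complex (ratr c.1.1) (ratr c.1.2)).
(* The triples [c] are countable, so all those [P c] that hold a.e. hold together off one null set;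
   [pickle] turns them into a sequence. *)
have good : \forall t \ae mu, forall c, (\forall s \ae mu, P c s) -> P c t.
  pose Q k t := if unpickle k is Some c then
    (\forall s \ae mu, P c s) -> P c t else True.
  have : \forall t \ae mu, forall k, Q k t.
    apply: ae_foralln => k; rewrite /Q; case: (unpickle k) => [c|]; last exact: aeW.
    have [Pc|nPc] := pselect (\forall s \ae mu, P c s).
      by apply: filterS Pc => t.
    exact: aeW.
  by apply: filterS => t Qt c; have := Qt (pickle c); rewrite /Q pickleK.
apply: filterS good => t good; rewrite leNgt; apply/negP => z1.
set z := phi t in z1.
have [e e0 ze] : exists2 e : R, 0 < e & \forall s \ae mu, e <= nc (phi s - z).
  apply: spectrum_phi_ball => // /sT /=.
  by rewrite normcE lecR leNgt z1.
(* A disc of radius below e / 2 that contains [z] lies in the ball of radius [e] about [z], which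
   [phi] avoids a.e. By [good], [phi t] avoids the disc too, although [phi t = z]. *)
have [n ne] : exists n : nat, n.+1%:R^-1 < e / 2.
  have /ltr_add_invr[n] : (0 : R) < e / 2 by rewrite divr_gt0.
  by rewrite add0r => ne; exists n.
have n0 : (0 : R) < n.+1%:R^-1 by rewrite invr_gt0.
have Q (a : R) : exists q : rat, `|a - ratr q| < n.+1%:R^-1 / 2.
  have /rat_in_itvoo[q] : a - n.+1%:R^-1 / 2 < a + n.+1%:R^-1 / 2.
    by rewrite ltrBlDr -addrA ltrDl -splitr.
  by rewrite in_itv/= => qa; exists q; rewrite ltr_distlC.
have [q1 zq1] := Q (complex.Re z); have [q2 zq2] := Q (complex.Im z).
pose v : R[i] := Complex (ratr q1) (ratr q2).
have zv : nc (z - v) < n.+1%:R^-1.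
  apply: le_lt_trans (normc_le _) _; rewrite [ltRHS]splitr.
  by apply: ltrD; [case: (z) zq1|case: (z) zq2].
have : P (q1, q2, n) t.
  apply: good; apply: filterS ze => s zs; rewrite /P /= -/v leNgt; apply/negP => sv.
  have : nc (phi s - z) < e.
    have -> : phi s - z = (phi s - v) + (v - z) by rewrite addrA subrK.
    apply: le_lt_trans (le_normcD _ _) _; rewrite -(normcN (v - z)) opprB.
    by rewrite [ltRHS]splitr; apply: ltrD; exact: lt_trans ne.
  by rewrite ltNge zs.
by rewrite /P /= -/v -/z leNgt zv.
Qed.
End WCT_power_bounded.

(** * The cycle of equivalences *)

Theorem theorem2p3 (d : measure_display) (X : measurableType d) (R : realType)
    (mu : {sigma_finite_measure set X -> \bar R})
    (A : set (set X)) (A_sigma : sigma_algebra setT A)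
    (A_sub : A `<=` measurable)
    (A_sigma_finite : sigma_finite [set: g_sigma_algebraType A] mu)
    (u w : X -> R[i]) (uw : WCT_weights mu A u w) :
  let T := WCT mu A u w in
  let Euw := condexp mu A (fun x => u x * w x) in
  bounded_op (L2ip mu) T ->
  [<-> quasi_contraction (L2ip mu) 1 T;
       forall n : nat, (0 < n)%N -> quasi_contraction (L2ip mu) n T;
       exists2 n : nat, (0 < n)%N & quasi_contraction (L2ip mu) n T;
       \forall x \ae mu, Euw x != 0 -> `|Euw x| <= 1;
       power_bounded (L2ip mu) T;
       spectrum (L2ip mu) T `<=` [set z | `|z| <= 1]].
Proof.
move=> T Euw Tb.
have mu_le1 : (\forall x \ae mu, Euw x != 0 -> `|Euw x| <= 1) <->
    (\forall x \ae mu, Normc.normc (Euw x) <= 1).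
  split; apply: filterS => x; rewrite normcE lecR; last by [].
  by have [->|_ ->//] := eqVneq (Euw x) 0; rewrite Normc.normc0.
have TE x y := WCT_adjointE A_sigma A_sub A_sigma_finite uw x y Tb.
(* The implications from (v) to (vi) and from (vi) back to (i) pass through the bound on [Euw]. *)
tfae.
- by move=> T1 n; exact: (quasi_contraction1 TE T1).
- by move=> Tn; exists 1%N => //; exact: Tn.
- move=> [n _ /(quasi_contractionP TE) nT]; apply/mu_le1.
  exact: (quasi_contraction_phi A_sigma A_sub A_sigma_finite uw nT).
- move=> /mu_le1; exact: (phi_power_bounded A_sigma A_sub A_sigma_finite uw Tb).
- move=> /(power_bounded_phi A_sigma A_sub A_sigma_finite uw).
  exact: (phi_spectrum A_sigma A_sub A_sigma_finite uw Tb).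
- move=> /(spectrum_phi A_sigma A_sub A_sigma_finite uw) phi1.
  apply/(quasi_contractionP TE) => x.
  exact: (hnorm_iter_WCT_contract A_sigma A_sub A_sigma_finite uw x 0 1 phi1).
Qed.
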